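(* Let $n\ge1$, $\beta>0$ and $f\in C^\beta_c(\mathbb{R}^n)$ (compactly supported and $\beta$-Hölder continuous). Let $e^{t\Delta}$ be the Gauss–Weierstrass semigroup $(e^{t\Delta}f)(x)=(4\pi t)^{-n/2}\int_{\mathbb{R}^n}e^{-|x-y|^2/(4t)}f(y)\,dy$. Then for every $x\in\mathbb{R}^n$ the integral \[ \log(-\Delta)f(x):=\int_0^\infty\frac{e^{-t}f(x)-(e^{t\Delta}f)(x)}{t}\,dt \] converges and \[ \log(-\Delta)f(x)=c_n\int_{B_1(x)}\frac{f(x)-f(y)}{|x-y|^n}\,dy-c_n\int_{\mathbb{R}^n\setminus B_1(x)}\frac{f(y)}{|x-y|^n}\,dy+\rho_n f(x), \] where $c_n=\pi^{-n/2}\Gamma(n/2)=2/|S^{n-1}|$ and $\rho_n=2\log2+\psi(n/2)-\gamma$.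
   Context: $\gamma=-\Gamma'(1)$ is the Euler–Mascheroni constant, $\psi=\Gamma'/\Gamma$ is the digamma function, $B_1(x)$ is the Euclidean unit ball centered at $x$, $|S^{n-1}|$ is the surface area of the unit sphere. The displayed time integral is the pointwise form of the Bochner formula $\log(-\Delta)f=\int_0^\infty t^{-1}(e^{-t}f-e^{t\Delta}f)\,dt$ for the spectrally defined logarithmic Laplacian of the Laplacian on $L^2(\mathbb{R}^n)$. *)

(* Defs.v *)
From HB Require Import structures.
From mathcomp Require Import all_boot all_order all_algebra.
From mathcomp Require Import all_classical all_reals all_analysis.
Set Implicit Arguments. Unset Strict Implicit. Unset Printing Implicit Defensive.
Import Order.TTheory GRing.Theory Num.Theory.
Import numFieldNormedType.Exports.
Local Open Scope classical_set_scope.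
Local Open Scope ring_scope.

(* Points of R^n are n-tuples of reals, carrying the product (Borel)
   sigma-algebra generated by the coordinate maps (library instance). *)

Definition Ledist (R : realType) (n : nat) (x y : n.-tuple R) : R :=
  Num.sqrt (\sum_(i < n) (tnth x i - tnth y i) ^+ 2).

Definition Lenorm (R : realType) (n : nat) (y : n.-tuple R) : R :=
  Num.sqrt (\sum_(i < n) (tnth y i) ^+ 2).

Definition Lis_lebesgue_measure_n (R : realType) (n : nat)
  (mu : {measure set (n.-tuple R) -> \bar R}) : Prop :=
  forall A : 'I_n -> set R, (forall i, measurable (A i)) ->
    mu [set x | forall i, A i (tnth x i)] =
      (\prod_(i < n) (@lebesgue_measure R) (A i))%E.

Definition Lhas_compact_support (R : realType) (n : nat) (f : n.-tuple R -> R) : Prop :=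
  exists M : R, forall y, M < Lenorm y -> f y = 0.

Definition Lhoelder (R : realType) (n : nat) (a : R) (f : n.-tuple R -> R) : Prop :=
  exists C : R, forall x y, `|f x - f y| <= C * (Ledist x y) `^ a.

Definition Lheat (R : realType) (n : nat) (mu : {measure set (n.-tuple R) -> \bar R})
  (t : R) (f : n.-tuple R -> R) (x : n.-tuple R) : R :=
  (4 * pi * t) `^ (- (n%:R / 2)) *
  Rintegral mu setT (fun y => expR (- (Ledist x y ^+ 2 / (4 * t))) * f y).

Definition LGamma (R : realType) (s : R) : R :=
  Rintegral (@lebesgue_measure R) `]0, +oo[%classic
    (fun t => t `^ (s - 1) * expR (- t)).

Definition Ldigamma (R : realType) (s : R) : R := derive1 (@LGamma R) s / LGamma s.

Definition Leuler_gamma (R : realType) : R := - derive1 (@LGamma R) 1.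

Definition Lc_n (R : realType) (n : nat) : R :=
  pi `^ (- (n%:R / 2)) * LGamma (n%:R / 2).

Definition Lrho_n (R : realType) (n : nat) : R :=
  2 * ln 2 + Ldigamma (n%:R / 2 : R) - Leuler_gamma R.

(* Main.v *)
(* Write [G t y] for the heat kernel at distance [r = |x - y|] and [q = n/2].
   Since [\int_0^oo G t y dt/t = c_n / r^n], the splitting
     [e^{-t} f x - e^{t Delta} f x
        = \int G t y (f x 1_{r<1} - f y) dy + f x (e^{-t} - \int_{r<1} G t y dy)]
   and Fubini on its first term yield the two singular integrals; Hoelder
   continuity gives absolute convergence.  For the constant, if [E] is a standard
   exponential variable and [U] has the Gamma(q) law, then [e^{-t} = P(t < E)] and
   [\int_{r<1} G t y dy = P(t < 1/(4U))], and
   [\int_0^oo (1_{t<a} - 1_{t<1}) dt/t = ln a], so that the second term integrates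
   to [f x * (E[ln E] + E[ln (4U)]) = f x * (Gamma'(1) + 2 ln 2 + psi(q))].
   The law of [r^2] is found from the scaling of the volume of balls, normalised by
   the Gaussian integral. *)
Require Import Defs.
From HB Require Import structures.
From mathcomp Require Import all_boot all_order all_algebra.
From mathcomp Require Import all_classical all_reals all_analysis.
From mathcomp Require Import measurable_realfun ring lra.
Set Implicit Arguments. Unset Strict Implicit. Unset Printing Implicit Defensive.
Import Order.TTheory GRing.Theory Num.Theory.
Import numFieldNormedType.Exports.
Local Open Scope classical_set_scope.
Local Open Scope ring_scope.

(** The measure [mu] is known only through its values on boxes, so neither polar coordinates nor a
    substitution rule on R^n is at hand. Changes of variables are therefore stated as equalities of
    two measures, usually tested on a generating family of sets, and [ge0_integral_transfer] turns
    them into equalities of integrals. In the same spirit, the Gamma identities come from Tonelli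
    applied to an exponential tail and not from integration by parts or substitution. The volume of
    the unit ball stays an unknown [kappa] until the Gaussian integral has been computed in two
    ways. The reference indicator 1_{t<1} is forced by the divergence at t = 0 of both e^{-t} / t
    and the heat content of the ball divided by t: once it is subtracted from each, both are
    integrable separately, and it disappears in their difference. On the diagonal y = x the time
    integral of the kernel is infinite, but the numerator vanishes there, so the interchange of
    integrals needs no exceptional set. *)

(** * Measures given by a density, and transfer of integrals along maps *)

Section mdens.
Local Open Scope ereal_scope.
Context d (T : measurableType d) (R : realType).
Variables (mu : {measure set T -> \bar R}) (w : T -> \bar R).
Hypotheses (mw : measurable_fun setT w) (w0 : forall x, 0 <= w x).

(** The proofs of measurability and nonnegativity are arguments so that the measure structure can be
    attached to [mdens mw w0] itself. Values in [\bar R] admit infinite constants as densities,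
    which can occur for products of integrals. *)
Definition mdens of measurable_fun setT w & (forall x, 0 <= w x) : set T -> \bar R :=
  fun A => \int[mu]_(x in A) w x.

Let m := mdens mw w0.

Let m0 : m set0 = 0. Proof. by rewrite /m /mdens integral_set0. Qed.

Let m_ge0 A : 0 <= m A. Proof. exact: integral_ge0. Qed.

Let m_sigma_additive : semi_sigma_additive m.
Proof.
move=> /= F mF tF mUF; rewrite /m /mdens.
rewrite ge0_integral_bigcup//; last exact: measurable_funTS.
by apply: is_cvg_ereal_nneg_natsum_cond => n _ _; exact: integral_ge0.
Qed.

HB.instance Definition _ := isMeasure.Build _ _ _ (mdens mw w0) m0 m_ge0 m_sigma_additive.

Import HBNNSimple.

(** Monotone convergence along simple functions increasing to [g], on both sides, reduces the
    identity to indicators. *)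
Lemma integral_mdens (g : T -> \bar R) :
  measurable_fun setT g -> (forall x, 0 <= g x) ->
  \int[mdens mw w0]_x g x = \int[mu]_x (g x * w x).
Proof.
move=> mg g0.
pose g_ := nnsfun_approx measurableT mg.
have gcvg x : (g_ n x)%:E @[n --> \oo] --> g x by exact: cvg_nnsfun_approx.
have g_nd x : {homo (fun n => (g_ n x)%:E) : k l / (k <= l)%N >-> k <= l}.
  by move=> k l kl; rewrite lee_fin; exact/lefP/nd_nnsfun_approx.
transitivity (limn (fun n => \int[mdens mw w0]_x (g_ n x)%:E)).
  rewrite -monotone_convergence//.
  - by apply: eq_integral => x _; exact/esym/cvg_lim.
  - by move=> n; exact/measurable_EFinP/measurable_funTS.
  - by move=> n x _; rewrite lee_fin.
transitivity (limn (fun n => \int[mu]_x ((g_ n x)%:E * w x))); last first.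
  rewrite -monotone_convergence//.
  - apply: eq_integral => x _; apply/cvg_lim => //.
    (* Since [w x] may be infinite, the product of limits is safe only away from 0 times infinity.
       If [g x = 0], all approximants are 0 because they increase to [g x]. *)
    have [gx0|gx0] := eqVneq (g x) 0.
      rewrite gx0 mul0e (_ : (fun _ => _) = cst 0); first exact: cvg_cst.
      apply/funext => n /=.
      have : (g_ n x)%:E <= g x.
        rewrite -(cvg_lim _ (gcvg x))//; apply: lime_ge; first by apply/cvg_ex; exists (g x).
        by near=> k; apply: g_nd; near: k; exact: nbhs_infty_ge.
      rewrite gx0 => gn0; rewrite (_ : (g_ n x)%:E = 0) ?mul0e//.
      by apply/eqP; rewrite eq_le gn0/= lee_fin.
    have [wx0|wx0] := eqVneq (w x) 0.
      rewrite wx0 mule0 (_ : (fun _ => _) = cst 0); first exact: cvg_cst.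
      by apply/funext => n /=; rewrite mule0.
    apply: cvgeM => //; last exact: cvg_cst.
    by apply: neq0_mule_def; rewrite mule_eq0 negb_or gx0.
  - move=> n; apply: emeasurable_funM => //.
    exact/measurable_EFinP/measurable_funTS.
  - by move=> n x _; rewrite mule_ge0// lee_fin.
  - by move=> x _ k l kl; rewrite lee_wpmul2r//; exact: g_nd.
congr (limn _); apply/funext => n.
transitivity (\sum_(k \in range (g_ n)) \int[mdens mw w0]_x (k * \1_(g_ n @^-1` [set k]) x)%:E).
  under eq_integral do rewrite fimfunE -fsumEFin//.
  rewrite ge0_integral_fsum//.
  - by move=> y; exact/measurable_EFinP/measurable_funM.
  - by move=> y x _; rewrite nnfun_muleindic_ge0.
transitivity (\int[mu]_x (\sum_(k \in range (g_ n)) ((k * \1_(g_ n @^-1` [set k]) x)%:E * w x))); last first.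
  apply: eq_integral => x _.
  rewrite -ge0_mule_fsuml//; last by move=> y; exact: nnfun_muleindic_ge0.
  by rewrite fsumEFin// -fimfunE.
rewrite ge0_integral_fsum//; last 2 first.
- move=> y; apply: emeasurable_funM => //.
  exact/measurable_EFinP/measurable_funM.
- by move=> y x _; rewrite mule_ge0// nnfun_muleindic_ge0.
apply: eq_fsbigr => r; rewrite inE => -[z _ zr].
have r0 : (0 <= r)%R by rewrite -zr.
under eq_integral do rewrite EFinM.
rewrite (@ge0_integralZl_EFin _ _ _ _ _ _ (EFin \o \1_(g_ n @^-1` [set r])))//; last 2 first.
- by move=> x _; rewrite lee_fin.
- exact/measurable_EFinP.
rewrite integral_indic// setIT.
transitivity (\int[mu]_x (r%:E * ((\1_(g_ n @^-1` [set r]) x)%:E * w x))); last first.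
  by apply: eq_integral => x _; rewrite muleA.
rewrite (@ge0_integralZl_EFin _ _ _ _ _ _ (fun x => (\1_(g_ n @^-1` [set r]) x)%:E * w x))//; last 2 first.
- by move=> x _; rewrite mule_ge0.
- by apply: emeasurable_funM => //; exact/measurable_EFinP.
congr (_ * _); rewrite /= /mdens integral_mkcond/=.
apply: eq_integral => x _; rewrite patchE indicE.
by case: (x \in _); rewrite ?mul1e ?mul0e.
Unshelve. all: by end_near. Qed.
End mdens.

Section transfer.
Local Open Scope ereal_scope.
Context d1 d2 d (T1 : measurableType d1) (T2 : measurableType d2)
  (Y : measurableType d) (R : realType).
Variables (m1 : {measure set T1 -> \bar R}) (m2 : {measure set T2 -> \bar R}).
Variables (w1 : T1 -> \bar R) (w2 : T2 -> \bar R) (phi1 : T1 -> Y) (phi2 : T2 -> Y).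
Hypotheses (mw1 : measurable_fun setT w1) (w10 : forall x, 0 <= w1 x).
Hypotheses (mw2 : measurable_fun setT w2) (w20 : forall x, 0 <= w2 x).
Hypotheses (mphi1 : measurable_fun setT phi1) (mphi2 : measurable_fun setT phi2).

Let integral_phi d' (T : measurableType d') (m : {measure set T -> \bar R})
    (w : T -> \bar R) (phi : T -> Y) (mw : measurable_fun setT w)
    (w0 : forall x, 0 <= w x) (g : Y -> \bar R) :
  measurable_fun setT phi -> measurable_fun setT g -> (forall y, 0 <= g y) ->
  \int[pushforward (mdens m mw w0) phi]_y g y = \int[m]_x (g (phi x) * w x).
Proof.
move=> mphi mg g0; rewrite ge0_integral_pushforward//= integral_mdens//.
exact: measurableT_comp.
Qed.

(** Both sides integrate [g] against the same measure on [Y], namely the image of a measure with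
    density under [phi1] or [phi2]. This serves as the change of variables for coordinate
    projections, translations and squared distances. *)
Lemma ge0_integral_transfer :
  (forall B, measurable B ->
    \int[m1]_(x in phi1 @^-1` B) w1 x = \int[m2]_(x in phi2 @^-1` B) w2 x) ->
  forall g : Y -> \bar R, measurable_fun setT g -> (forall y, 0 <= g y) ->
  \int[m1]_x (g (phi1 x) * w1 x) = \int[m2]_x (g (phi2 x) * w2 x).
Proof.
move=> eqB g mg g0; rewrite -(integral_phi _ mw1 w10)// -(integral_phi _ mw2 w20)//.
apply: (@eq_measure_integral _ _ _ _ (pushforward (mdens m2 mw2 w20) phi2) (pushforward (mdens m1 mw1 w10) phi1)) => // B mB _.
exact: eqB.
Qed.

End transfer.

(** Bundles the pushforward as a measure known by its values, the form in which it can be rescaled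
    and fed to uniqueness theorems. *)
Lemma pushforward_measure d1 d (T : measurableType d1) (Y : measurableType d)
    (R : realType) (m : {measure set T -> \bar R}) (phi : T -> Y) :
  measurable_fun setT phi ->
  exists P : {measure set Y -> \bar R}, forall A, P A = m (phi @^-1` A).
Proof.
move=> mphi.
suff H : forall P : {measure set Y -> \bar R},
    (P : set Y -> \bar R) = pushforward m phi ->
    exists P : {measure set Y -> \bar R}, forall A, P A = m (phi @^-1` A).
  exact: (H _ erefl).
by move=> P PE; exists P => A; rewrite PE.
Qed.

(** * Lebesgue measure on R^n, determined by its values on boxes *)

Section lebesgue_n.
Context (R : realType) (n : nat) (mu : {measure set (n.-tuple R) -> \bar R}).
Hypothesis Hmu : Lis_lebesgue_measure_n mu.

Lemma measurable_box (A : 'I_n -> set R) : (forall i, measurable (A i)) ->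
  measurable [set x : n.-tuple R | forall i, A i (tnth x i)].
Proof.
move=> mA; rewrite (_ : [set x | _] = \bigcap_(i in [set: 'I_n]) ((fun x => tnth x i) @^-1` A i)).
  apply: fin_bigcap_measurable => // i _; rewrite -[_ @^-1` _]setTI.
  exact: measurable_tnth.
by apply/seteqP; split => x //= Ax i; [move=> _|]; exact: Ax.
Qed.

Lemma measurable_prod_tnth (P : pred 'I_n) (g : 'I_n -> R -> R) :
  (forall i, measurable_fun setT (g i)) ->
  measurable_fun setT (fun y : n.-tuple R => \prod_(i | P i) g i (tnth y i)).
Proof.
move=> mg; under eq_fun => y do rewrite big_mkcond.
apply: (measurable_prod (h := fun i (y : n.-tuple R) => if P i then g i (tnth y i) else 1)) => i _.
case: (P i) => //.
by apply: (@measurableT_comp _ _ _ _ _ _ (g i)) => //; exact: measurable_tnth.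
Qed.

(** Induction on the number [k] of leading coordinates that carry an arbitrary factor, the others
    carrying indicators. For [k = 0] this is the box formula. One more general factor is allowed
    because, with the remaining factors as density, the image measure on that axis is a constant
    multiple of Lebesgue measure. *)
Lemma integral_prod_tnth (g : 'I_n -> R -> R) :
  (forall i, measurable_fun setT (g i)) -> (forall i u, 0 <= g i u) ->
  (\int[mu]_y (\prod_i g i (tnth y i))%:E =
   \prod_i \int[@lebesgue_measure R]_u (g i u)%:E)%E.
Proof.
suff H k : forall g : 'I_n -> R -> R,
    (forall i, measurable_fun setT (g i)) -> (forall i u, 0 <= g i u) ->
    (forall i : 'I_n, (k <= i)%N -> exists2 A, measurable A & g i = \1_A) ->
    (\int[mu]_y (\prod_i g i (tnth y i))%:E =
     \prod_i \int[@lebesgue_measure R]_u (g i u)%:E)%E.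
  by move=> mg g0; apply: (H n) => // i; rewrite leqNgt ltn_ord.
elim: k => [|k IH] {}g mg g0 gA.
  have /choice[A AE] : forall i, exists A, measurable A /\ g i = \1_A.
    by move=> i; have [//|A mA gE] := gA i; exists A.
  under eq_integral => y _.
    rewrite (_ : \prod_i _ = \1_[set y : n.-tuple R | forall i, A i (tnth y i)] y); last first.
      rewrite indicE; case: (boolP (y \in _)).
        rewrite inE => /= yA; apply: big1 => i _.
        by rewrite (AE i).2 indicE mem_set//; exact: yA.
      rewrite notin_setE/= => /existsNP[i /= yA].
      by rewrite (bigD1 i)//= (AE i).2 indicE memNset ?mul0r.
    over.
  have mA i : measurable (A i) by exact: (AE i).1.
  rewrite integral_indic ?setIT ?Hmu//; last exact: measurable_box.
  by apply: eq_bigr => i _; rewrite (AE i).2 integral_indic ?setIT//; exact: mA.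
have [kn|nk] := ltnP k n; last first.
  by apply: IH => // i ki; have := leq_trans nk ki; rewrite leqNgt ltn_ord.
pose i0 := Ordinal kn.
pose w (y : n.-tuple R) := (\prod_(i | i != i0) g i (tnth y i))%:E.
pose C := (\prod_(i | i != i0) \int[@lebesgue_measure R]_u (g i u)%:E)%E.
have w0 y : (0 <= w y)%E by rewrite lee_fin prodr_ge0.
have mw : measurable_fun setT w.
  by apply/measurable_EFinP; exact: measurable_prod_tnth.
have C0 : (0 <= C)%E by apply: prode_ge0 => i _; apply: integral_ge0 => x _; rewrite lee_fin.
(* The induction hypothesis, with an indicator in place of [g i0], says that the marginal along the
   axis [i0] is [C] times Lebesgue measure; [C] may be infinite. *)
have nuE A : measurable A ->
    (\int[mu]_(y in (fun y => tnth y i0) @^-1` A) w y = \int[@lebesgue_measure R]_(u in id @^-1` A) C)%E.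
  move=> mA; rewrite preimage_id integral_cst//.
  pose g' i := if i == i0 then \1_A else g i.
  have g'0 : g' i0 = \1_A by rewrite /g' eqxx.
  have g'E i : i != i0 -> g' i = g i by rewrite /g' => /negbTE ->.
  transitivity (\int[mu]_y (\prod_i g' i (tnth y i))%:E)%E.
    rewrite integral_mkcond; apply: eq_integral => y _.
    rewrite patchE (bigD1 i0)//= g'0 indicE.
    rewrite [in RHS](eq_bigr (fun i => g i (tnth y i))); last by move=> i /g'E ->.
    have [yA|yA] := boolP (tnth y i0 \in A).
      by rewrite mem_set ?mul1r//; exact/set_mem.
    by rewrite memNset ?mul0r//; move: yA; rewrite notin_setE.
  rewrite IH; first last.
  - move=> i ki; have [->|ii0] := eqVneq i i0; first by exists A.
    rewrite g'E//; apply: gA; rewrite ltn_neqAle ki andbT; apply: contra ii0 => /eqP ki0.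
    by apply/eqP/val_inj.
  - by move=> i u; rewrite /g'; case: ifP => // _; rewrite indicE.
  - by move=> i; rewrite /g'; case: ifP.
  rewrite (bigD1 i0)//= g'0 integral_indic ?setIT// muleC; congr (_ * _)%E.
  by apply: eq_bigr => i ii0; rewrite g'E.
have : (\int[mu]_y ((g i0 (tnth y i0))%:E * w y) = \int[@lebesgue_measure R]_u ((g i0 u)%:E * C))%E.
  apply: (@ge0_integral_transfer _ _ _ _ (measurableTypeR R) R _ mu lebesgue_measure w (cst C)
     (fun y => tnth y i0) id mw w0 _ (fun=> C0) _ _ nuE (fun u => (g i0 u)%:E)) => //; first [exact: measurable_tnth | exact/measurable_EFinP | (move=> u; have := g0 i0 u; rewrite -lee_fin; exact)].
have mgE : measurable_fun setT (EFin \o g i0) by exact/measurable_EFinP.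
rewrite (@ge0_integralZr _ (measurableTypeR R) R lebesgue_measure setT measurableT (EFin \o g i0))//; last first.
  by move=> u _; rewrite lee_fin.
move=> E; rewrite [RHS](bigD1 i0)//= -/C -E.
by apply: eq_integral => y _; rewrite -EFinM (bigD1 i0).
Qed.

End lebesgue_n.

(** The pushforward by the affine map, multiplied by [s], gives each half-open interval its length,
    hence is Lebesgue measure. *)
Lemma lebesgue_measure_affine (R : realType) (a s : R) (A : set R) : 0 < s ->
  measurable A ->
  lebesgue_measure ((fun u => a + s * u) @^-1` A) = (s^-1%:E * lebesgue_measure A)%E.
Proof.
move=> s0 mA.
pose phi (u : measurableTypeR R) : measurableTypeR R := a + s * u.
have mphi : measurable_fun setT phi.
  by apply: measurable_funD => //; exact: measurable_funM.
have [P PE] := pushforward_measure lebesgue_measure mphi.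
suff -> : lebesgue_measure A = mscale (NngNum (ltW s0)) P A.
  by rewrite /= /mscale/= PE muleA -EFinM mulVf ?gt_eqF// mul1e.
apply: lebesgue_measure_unique => //.
move=> _ [[p q] _ <-] /=; rewrite /mscale/= PE.
rewrite (_ : _ @^-1` _ = `](p - a) / s, (q - a) / s]%classic); last first.
  apply/seteqP; split => u /=; rewrite !in_itv/= ltr_pdivrMr// ler_pdivlMr// mulrC;
   by rewrite ltrBlDl lerBrDl.
rewrite !lebesgue_measure_itv/= !lte_fin !lebesgue_measure_itv/= !lte_fin ltr_pM2r ?invr_gt0// ltrD2r.
case: ifPn => pq; last by rewrite mule0.
by rewrite -EFinB -EFinM; congr EFin; field; rewrite gt_eqF.
Qed.

Section lebesgue_n.
Context (R : realType) (n : nat).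
Implicit Types mu : {measure set (n.-tuple R) -> \bar R}.

(** Boxes are stable under intersection and generate the product sigma-algebra, and the cubes with
    sides []- k, k]], of finite measure, exhaust the space. *)
Lemma lebesgue_n_unique mu mu' :
  Lis_lebesgue_measure_n mu -> Lis_lebesgue_measure_n mu' ->
  forall A, measurable A -> mu A = mu' A.
Proof.
move=> H H' A mA.
pose G := [set B : set (n.-tuple R) | exists2 A : 'I_n -> set R,
  (forall i, measurable (A i)) & B = [set x | forall i, A i (tnth x i)]].
pose g (k : nat) := [set x : n.-tuple R | forall i, `](- k%:R), k%:R[%classic (tnth x i)].
apply: (measure_unique G g) => //.
- apply/seteqP; split.
    apply: smallest_sub; first exact: smallest_sigma_algebra.
    rewrite -bigcup_seq => B /= [i _ [Y mY <-]].
    apply: sub_sigma_algebra => /=.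
    exists (fun j => if j == i then Y else setT); first by move=> j; case: ifP.
    apply/seteqP; split => x /= => [[_ Yx] j|Yx].
      by case: eqP => // ->.
    by split => //; have := Yx i; rewrite eqxx.
  apply: smallest_sub; first exact: sigma_algebra_measurable.
  by move=> _ [B mB ->]; exact: measurable_box.
- move=> _ _ [B mB ->] [C mC ->]; exists (fun i => B i `&` C i).
    by move=> i; exact: measurableI.
  apply/seteqP; split => x /= => [[Bx Cx] i|BC]; first by split.
  by split => i; have [] := BC i.
- by move=> k; exists (fun=> `](- k%:R), k%:R[%classic).
- apply/seteqP; split => // x _.
  exists (Num.bound (\sum_i `|tnth x i|)) => // i /=.
  rewrite in_itv/= -ltr_norml (le_lt_trans _ (archi_boundP _))// ?sumr_ge0//.
  by rewrite (bigD1 i)//= lerDl sumr_ge0.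
- by move=> _ [B mB ->]; rewrite H ?H'.
- move=> k; rewrite /g (H (fun=> `](- k%:R), k%:R[%classic))// ltey_eq; apply/orP; left.
  apply: (big_ind (fun z => z \is a fin_num)) => //; first exact: fin_numM.
  by move=> i _; rewrite lebesgue_measure_itv/=; case: ifP.
Qed.

Lemma measurable_Ledist (x : n.-tuple R) : measurable_fun setT (Ledist x).
Proof.
apply: (@measurableT_comp _ _ _ _ _ _ (@Num.sqrt R)).
  by apply: continuous_measurable_fun; exact: sqrt_continuous.
apply: measurable_sum => i; apply: measurable_funX; apply: measurable_funB => //.
exact: measurable_tnth.
Qed.

(** The homothety [T] of centre [x] and ratio [rho] carries the unit ball onto the ball of radius
    [rho], and [rho ^+ n] times the image of [mu] under [T] has the box values of [mu]. *)
Lemma measure_ball mu (x : n.-tuple R) (rho : R) : Lis_lebesgue_measure_n mu -> 0 < rho ->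
  mu [set y | Ledist x y < rho] = ((rho ^+ n)%:E * mu [set y | (Ledist x y < 1)%R])%E.
Proof.
move=> Hmu rho0.
pose T (y : n.-tuple R) := [tuple (tnth x i - rho * tnth x i) + rho * tnth y i | i < n].
have mT : measurable_fun setT T.
  apply/measurable_fun_tnthP => i; rewrite /comp /T.
  under eq_fun do rewrite tnth_mktuple.
  by apply: measurable_funD => //; apply: measurable_funM => //; exact: measurable_tnth.
have mball r : measurable [set y | Ledist x y < r].
  rewrite -[X in measurable X]setTI (_ : [set y | _] = Ledist x @^-1` `]-oo, r[%classic).
    exact: measurable_Ledist.
  by apply/seteqP; split => y /=; rewrite in_itv.
have r0 : 0 <= rho ^+ n by rewrite exprn_ge0// ltW.
have [P PE] := pushforward_measure mu mT.
rewrite (@lebesgue_n_unique mu (mscale (NngNum r0) P))//.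
  rewrite /= /mscale/= PE; congr (_ * mu _)%E.
  apply/seteqP; split => y /=;
  rewrite (_ : Ledist x (T y) = rho * Ledist x y) ?gtr_pMr// /Ledist -[X in X * _]gtr0_norm// -sqrtr_sqr -sqrtrM ?sqr_ge0//;
  by rewrite mulr_sumr; congr Num.sqrt; apply: eq_bigr => i _; rewrite tnth_mktuple; ring.
move=> A mA /=; rewrite /mscale/= PE.
rewrite (_ : _ @^-1` _ = [set y | forall i, ((fun u => (tnth x i - rho * tnth x i) + rho * u) @^-1` A i) (tnth y i)]); last first.
  by apply/seteqP; split => y /= Ay i; have := Ay i; rewrite tnth_mktuple.
rewrite (Hmu (fun i => (fun u => (tnth x i - rho * tnth x i) + rho * u) @^-1` A i)); last first.
  move=> i; rewrite -[X in measurable X]setTI.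
  have mphi : measurable_fun setT (fun u : R => (tnth x i - rho * tnth x i) + rho * u).
    by apply: measurable_funD => //; exact: measurable_funM.
  exact: mphi.
rewrite (eq_bigr (fun i => rho^-1%:E * lebesgue_measure (A i))%E); last by move=> i _; exact: lebesgue_measure_affine.
rewrite big_split/= prodEFin muleA -EFinM prodr_const card_ord.
by rewrite exprVn divff ?mul1e// expf_neq0// gt_eqF.
Qed.

End lebesgue_n.

(** * Explicit integrals of powers and exponentials *)

Section calculus.
Context {R : realType}.
Local Notation leb := (@lebesgue_measure R).
Implicit Types (f F : R -> R) (a b q : R).

Lemma integral_FTC_oo f F a b : 0 < a -> a <= b ->
  (forall u : R, 0 < u -> is_derive u 1 F (f u)) ->
  (forall u : R, 0 < u -> {for u, continuous f}) ->
  (\int[leb]_(u in `]a, b[) (f u)%:E = (F b - F a)%:E)%E.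
Proof.
move=> a0; rewrite le_eqVlt => /predU1P[<-|ab] dF cf.
  by rewrite set_itvoo0 // integral_set0 subrr.
have cF u : 0 < u -> {for u, continuous F}.
  by move=> /dF [dFu _]; apply: differentiable_continuous; exact/derivable1_diffP.
rewrite -(@integral_itv_bndoo _ a b _ true false); last first.
  apply/measurable_EFinP; apply: open_continuous_measurable_fun => //.
  by move=> u; rewrite inE/= in_itv/= => /andP[au _]; apply: cf; exact: lt_trans au.
rewrite (@continuous_FTC2 _ f F a b ab)//.
- apply: continuous_in_subspaceT => u; rewrite inE/= in_itv/= => /andP[au _].
  by apply: cf; exact: lt_le_trans au.
- split.
  + by move=> u; rewrite in_itv/= => /andP[au _]; have [] := dF _ (lt_trans a0 au).
  + exact/cvg_at_right_filter/cF.
  + by apply/cvg_at_left_filter/cF; exact: lt_trans ab.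
- move=> u; rewrite in_itv/= => /andP[au _]; have dFu := dF _ (lt_trans a0 au).
  by rewrite derive1E derive_val.
Qed.

Lemma integral_FTC_oy f F a (l : R) : (forall u : R, a <= u -> 0 <= f u) ->
  (forall u : R, a <= u -> is_derive u 1 F (f u)) ->
  (forall u : R, a <= u -> {for u, continuous f}) ->
  F u @[u --> +oo] --> l ->
  (\int[leb]_(u in `]a, +oo[) (f u)%:E = (l - F a)%:E)%E.
Proof.
move=> f0 dF cf Fl.
have cF u : a <= u -> {for u, continuous F}.
  by move=> /dF [dFu _]; apply: differentiable_continuous; exact/derivable1_diffP.
rewrite integral_itv_obnd_cbnd; last first.
  apply/measurable_EFinP; apply: open_continuous_measurable_fun => //.
  by move=> u; rewrite inE/= in_itv/= andbT => au; apply: cf; exact: ltW.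
rewrite (@ge0_continuous_FTC2y _ f F a l)//.
- apply: continuous_in_subspaceT => u; rewrite inE/= in_itv/= andbT => au.
  exact: cf.
- by move=> u au; have [] := dF _ (ltW au).
- exact/cvg_at_right_filter/cF.
- move=> u; rewrite in_itv/= andbT => au; have dFu := dF _ (ltW au).
  by rewrite derive1E derive_val.
Qed.

Lemma continuous_powR_gt0 q u : 0 < u -> {for u, continuous (fun v => v `^ q)}.
Proof.
move=> u0; apply: differentiable_continuous; apply/derivable1_diffP.
by have [] := is_derive1_powR q u0.
Qed.

Lemma is_derive_powR_div q (u : R) : q != 0 -> 0 < u ->
  is_derive u 1 (fun v => v `^ q / q) (u `^ (q - 1)).
Proof.
move=> q0 u0; have dp := is_derive1_powR q u0.
rewrite (_ : (fun v => v `^ q / q) = q^-1 \*: (fun v => v `^ q)); last first.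
  by apply/funext => v /=; rewrite mulrC.
apply: is_derive_eq.
by rewrite /GRing.scale/= mulKf.
Qed.

Lemma integral_powR_oo q a b : q != 0 -> 0 < a -> a <= b ->
  (\int[leb]_(u in `]a, b[) (u `^ (q - 1))%:E = ((b `^ q - a `^ q) / q)%:E)%E.
Proof.
move=> q0 a0 ab; rewrite mulrBl; apply: (integral_FTC_oo (F := fun v => v `^ q / q)) => //.
- by move=> u u0; exact: is_derive_powR_div.
- by move=> u u0; exact: continuous_powR_gt0.
Qed.

Lemma integral_inv_oo a b : 0 < a -> a <= b ->
  (\int[leb]_(u in `]a, b[) (u^-1)%:E = (ln b - ln a)%:E)%E.
Proof.
move=> a0 ab; apply: (integral_FTC_oo (F := @ln R)) => //.
- by move=> u u0; apply: continuousV => //; rewrite gt_eqF.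
Qed.

Lemma cvg_powR_pinfty q : 0 < q -> u `^ (- q) @[u --> +oo] --> (0 : R).
Proof.
move=> q0; apply: (@cvg_trans _ (expR (- (q * ln u)) @[u --> +oo])).
  by apply: near_eq_cvg; near=> u; rewrite /powR gt_eqF// mulNr.
apply: (@cvg_comp _ _ _ (fun u => q * ln u) (fun u => expR (- u)) _ (+oo)); last exact: cvgr_expR.
apply: gt0_cvgMry => //; apply/cvgryPge => A; near=> u.
by rewrite -[A]expRK ler_ln ?posrE ?expR_gt0.
Unshelve. all: by end_near. Qed.

Lemma cvg_powR_seq q b : 0 < q -> 0 < b ->
  (b / k.+1%:R) `^ q @[k --> \oo] --> (0 : R).
Proof.
move=> q0 b0; apply: (cvg_comp (fun k => b / k.+1%:R) (fun u => u `^ q)); last exact: (powR_cvg0 q0).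
move=> P [d /= d0 dP]; near=> k; apply: dP => /=; last by rewrite divr_gt0.
rewrite sub0r normrN gtr0_norm ?divr_gt0// ltr_pdivrMr// mulrC -ltr_pdivrMr//.
apply: (lt_le_trans (archi_boundP _)); first by rewrite divr_ge0// ltW.
by rewrite ler_nat ltnW// ltnS; near: k; exact: nbhs_infty_ge.
Unshelve. all: by end_near. Qed.

(** The integrand is unbounded at 0 when [q < 1]; the fundamental theorem is applied on the
    intervals from [b / (k + 1)] to [b], which increase to the whole interval. *)
Lemma integral_powR_0o q b : 0 < q -> 0 < b ->
  (\int[leb]_(u in `]0%R, b[) (u `^ (q - 1))%:E = (b `^ q / q)%:E)%E.
Proof.
move=> q0 b0.
pose F (k : nat) := `](b / k.+1%:R), b[%classic : set R.
have F0 k : 0 < b / k.+1%:R by rewrite divr_gt0.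
have UF : \bigcup_k F k = `]0, b[%classic.
  apply/seteqP; split => u /=.
    by move=> [k _]; rewrite /F/= !in_itv/= => /andP[ku ->]; rewrite (lt_trans (F0 k)).
  rewrite in_itv/= => /andP[u0 ub]; exists (Num.bound (b / u)) => //.
  rewrite /F/= in_itv/= ub andbT ltr_pdivrMr// mulrC -ltr_pdivrMr//.
  apply: (lt_le_trans (archi_boundP _)); first by rewrite divr_ge0// ltW.
  by rewrite ler_nat.
have mp k : measurable_fun (F k) (fun u : R => (u `^ (q - 1))%:E).
  by apply/measurable_EFinP; apply: measurable_funTS; exact: measurable_powR.
have ndF : nondecreasing_seq F.
  move=> k l kl; apply/subsetPset => u; rewrite /F/= !in_itv/= => /andP[ku ->].
  rewrite andbT (le_lt_trans _ ku)// ler_pM2l// lef_pV2 ?posrE// ler_nat.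
  by rewrite ltnS.
have := @ge0_nondecreasing_set_cvg_integral _ (measurableTypeR R) R F (fun u => (u `^ (q - 1))%:E) leb ndF
  (fun k => measurable_itv _) mp (fun k u _ => powR_ge0 u (q - 1)).
rewrite UF => /cvg_lim <-//; apply/cvg_lim => //.
under eq_fun => k.
  rewrite integral_powR_oo ?gt_eqF//; last by rewrite ler_pdivrMr// ler_peMr ?(ltW b0)// ler1n.
  over.
apply: cvg_EFin; first exact: nearW.
rewrite /comp/= -[X in X / q]subr0.
apply: cvgM; last exact: cvg_cst.
apply: cvgB; first exact: cvg_cst.
exact: cvg_powR_seq.
Qed.

Lemma integral_powR_oy q a : 0 < q -> 0 < a ->
  (\int[leb]_(u in `]a, +oo[) (u `^ (- q - 1))%:E = (a `^ (- q) / q)%:E)%E.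
Proof.
move=> q0 a0; rewrite (_ : a `^ (- q) / q = 0 - a `^ (- q) / (- q)); last first.
  by rewrite sub0r invrN mulrN opprK.
apply: (integral_FTC_oy (F := fun v => v `^ (- q) / (- q))).
- by move=> u _; exact: powR_ge0.
- move=> u au; apply: is_derive_powR_div; first by rewrite oppr_eq0 gt_eqF.
  exact: lt_le_trans au.
- by move=> u au; apply: continuous_powR_gt0; exact: lt_le_trans au.
- rewrite -[X in _ --> X](mul0r (- q)^-1).
  by apply: cvgM; [exact: cvg_powR_pinfty|exact: cvg_cst].
Qed.

Lemma integral_expRN_oy a :
  (\int[leb]_(u in `]a, +oo[) (expR (- u))%:E = (expR (- a))%:E)%E.
Proof.
rewrite -[expR (- a)]opprK -[- - expR _]sub0r.
apply: (integral_FTC_oy (F := fun v => - expR (- v))) => //.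
- move=> u u0.
  have dN : is_derive u 1 (fun v : R => expR (- v)) (- expR (- u)).
    have h : is_derive (- u) 1 expR (expR (- u)) by exact: is_derive_expR.
    have := @is_derive1_comp R expR (-%R) u _ _ h (is_deriveNid u 1).
    by rewrite mulrN1.
  by apply: is_derive_eq; rewrite opprK.
- move=> u u0; apply: continuous_comp; first exact: continuousN.
  exact: continuous_expR.
- rewrite -oppr0; apply: cvgN; exact: cvgr_expR.
Qed.

End calculus.

(** * The Gaussian integral on R^n and finiteness of the volume of balls *)

Section gauss.
Context (R : realType).

Lemma integral_gauss_shift (a : R) :
  (\int[@lebesgue_measure R]_u (expR (- (a - u) ^+ 2))%:E = (Num.sqrt pi)%:E)%E.
Proof.
have mphi : measurable_fun setT (fun u : R => - a + 1 * u).
  by apply: measurable_funD => //; exact: measurable_funM.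
have mg : measurable_fun setT (fun u : R => (gauss_fun u)%:E).
  by apply/measurable_EFinP; exact: measurable_gauss_fun.
have E : (\int[@lebesgue_measure R]_u ((gauss_fun (- a + 1 * u))%:E * 1) =
    \int[@lebesgue_measure R]_u ((gauss_fun u)%:E * 1))%E.
  apply: (@ge0_integral_transfer _ _ _ (measurableTypeR R) (measurableTypeR R) R R
    lebesgue_measure lebesgue_measure (cst 1%E) (cst 1%E) (fun u => - a + 1 * u) id
    _ _ _ _ _ _ _ (fun u => (gauss_fun u)%:E)) => //;
    last by move=> u; rewrite lee_fin gauss_fun_ge0.
  move=> B mB; rewrite !integral_cst//.
    rewrite !mul1e preimage_id; have := lebesgue_measure_affine (- a) ltr01 mB.
    by rewrite invr1 mul1e.
  by rewrite -[X in measurable X]setTI; exact: mphi.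
transitivity (\int[@lebesgue_measure R]_u (gauss_fun u)%:E)%E; last exact: integralT_gauss.
under [RHS]eq_integral do rewrite -[(gauss_fun _)%:E]mule1.
rewrite -E; apply: eq_integral => u _; rewrite mule1 /gauss_fun mul1r.
by rewrite -sqrrN opprB addrC.
Qed.

Context (n : nat) (mu : {measure set (n.-tuple R) -> \bar R}).
Hypothesis Hmu : Lis_lebesgue_measure_n mu.

Lemma Ledist_sqr (x y : n.-tuple R) : Ledist x y ^+ 2 = \sum_(i < n) (tnth x i - tnth y i) ^+ 2.
Proof. by rewrite sqr_sqrtr// sumr_ge0// => i _; exact: sqr_ge0. Qed.

Lemma integral_gauss_n (x : n.-tuple R) :
  (\int[mu]_y (expR (- (Ledist x y ^+ 2)))%:E = (pi `^ (n%:R / 2))%:E)%E.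
Proof.
under eq_integral do rewrite Ledist_sqr -sumrN expR_sum.
rewrite (integral_prod_tnth Hmu (g := fun i u => expR (- (tnth x i - u) ^+ 2))); last 2 first.
- move=> i; apply: measurableT_comp => //; apply: measurableT_comp => //.
  by apply: measurable_funX; exact: measurable_funB.
- by move=> i u; exact: expR_ge0.
under eq_bigr do rewrite integral_gauss_shift.
rewrite prodEFin prodr_const card_ord; congr EFin.
by rewrite mulrC powRrM powR12_sqrt ?pi_ge0// powR_mulrn// sqrtr_ge0.
Qed.

Lemma le_coord_Ledist (x y : n.-tuple R) i : `|tnth x i - tnth y i| <= Ledist x y.
Proof.
rewrite -ler_sqr ?nnegrE// ?sqrtr_ge0// Ledist_sqr -normrX ger0_norm ?sqr_ge0//.
by rewrite (bigD1 i)//= lerDl sumr_ge0// => j _; exact: sqr_ge0.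
Qed.

Lemma measurable_ball_Ledist (x : n.-tuple R) r : measurable [set y | Ledist x y < r].
Proof.
rewrite -[X in measurable X]setTI (_ : [set y | _] = Ledist x @^-1` `]-oo, r[%classic).
  exact: measurable_Ledist.
by apply/seteqP; split => y /=; rewrite in_itv.
Qed.

Lemma measure_ball_lty (x : n.-tuple R) r : (mu [set y | (Ledist x y < r)%R] < +oo)%E.
Proof.
pose B i := `](tnth x i - r), (tnth x i + r)[%classic : set R.
apply: (@le_lt_trans _ _ (mu [set y | forall i, B i (tnth y i)])).
  apply: le_measure; [|by rewrite inE; apply: measurable_box => i; exact: measurable_itv|].
    by rewrite inE; exact: measurable_ball_Ledist.
  move=> y /= xyr i; rewrite /B/= in_itv/= -ltr_distlC.
  by rewrite (le_lt_trans _ xyr)// le_coord_Ledist.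
rewrite (Hmu (fun i => measurable_itv _)) ltey_eq; apply/orP; left.
apply: (big_ind (fun z => z \is a fin_num)) => //; first exact: fin_numM.
by move=> i _; rewrite lebesgue_measure_itv/=; case: ifP.
Qed.

End gauss.

(** * The law of the squared distance to a point *)

Section radial.
Context (R : realType) (n : nat) (mu : {measure set (n.-tuple R) -> \bar R}).
Hypotheses (Hmu : Lis_lebesgue_measure_n mu) (n0 : (0 < n)%N).
Variable x : n.-tuple R.
Local Notation leb := (@lebesgue_measure R).
Local Notation kappa := (fine (mu [set y | Ledist x y < 1])).
Local Notation q := (n%:R / 2 : R).



Let kappa0 : 0 <= kappa. Proof. exact: fine_ge0. Qed.

Let q0 : 0 < q. Proof. by rewrite divr_gt0// ltr0n. Qed.

Lemma Ledist_ge0 (y : n.-tuple R) : 0 <= Ledist x y. Proof. exact: sqrtr_ge0. Qed.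

Let radial_cdf (c b : R) : 0 < c -> 0 < b ->
  mu [set y | Ledist x y ^+ 2 / c < b] = (kappa * (c `^ q * b `^ q))%:E.
Proof.
move=> c0 b0; have cb0 : 0 < c * b by rewrite mulr_gt0.
rewrite (_ : [set y | _] = [set y | Ledist x y < Num.sqrt (c * b)]); last first.
  by apply/seteqP; split => y /=;
    rewrite ltr_pdivrMr// [b * c]mulrC -(ltr_sqrt _ cb0) sqrtr_sqr ger0_norm// Ledist_ge0.
rewrite measure_ball ?sqrtr_gt0// -[mu _]fineK; last first.
  by rewrite ge0_fin_numE// measure_ball_lty.
rewrite -EFinM -/kappa mulrC -powRM ?ltW//; congr (kappa * _)%:E.
by rewrite [n%:R / 2]mulrC powRrM powR12_sqrt ?(ltW cb0)// powR_mulrn ?sqrtr_ge0.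
Qed.

Lemma measurable_Ledist_sqr (c : R) :
  measurable_fun setT (fun y : n.-tuple R => Ledist x y ^+ 2 / c).
Proof. by apply: measurable_funM => //; apply: measurable_funX; exact: measurable_Ledist. Qed.

(** Stands in for polar coordinates. By [radial_cdf], the image of [mu] under r^2 / c gives the ray
    []-oo, b[] the mass kappa (c b)^q, whose derivative in b is the weight on the right; agreement
    on rays implies agreement of the measures. *)
Lemma radial_kappa (c : R) (g : R -> \bar R) : 0 < c ->
  measurable_fun setT g -> (forall u, 0 <= g u)%E ->
  (\int[mu]_y g (Ledist x y ^+ 2 / c)%R =
   \int[leb]_(u in `]0%R, +oo[) (g u * (kappa * q * c `^ q * u `^ (q - 1))%:E))%E.
Proof.
move=> c0 mg g0.
pose W0 (u : R) := (kappa * q * c `^ q * u `^ (q - 1))%:E.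
(* The weight is cut to the positive half-line because measures on the whole line are compared; for
   [b <= 0] both then vanish on []-oo, b[]. *)
pose W := W0 \_ `]0, +oo[ : measurableTypeR R -> \bar R.
have mW0 : measurable_fun setT W0.
  by apply/measurable_EFinP; apply: measurable_funM => //; exact: measurable_powR.
have mW : measurable_fun setT W.
  by apply/(measurable_restrictT _ _).1 => //; exact: measurable_funTS.
have W0_ge0 u : (0 <= W0 u)%E.
  by rewrite lee_fin !mulr_ge0 ?powR_ge0// ltW.
have W_ge0 u : (0 <= W u)%E by rewrite /W patchE; case: ifP.
have [P PE] := @pushforward_measure _ _ _ (measurableTypeR R) _ mu _ (measurable_Ledist_sqr c).
have PW (B : set (measurableTypeR R)) : measurable B -> P B = mdens leb mW W_ge0 B.
  apply: (@measure_unique _ R (measurableTypeR R) (@RGenInftyO.G R) (fun k => `]-oo, k%:R[%classic) _ _ _ _ P (mdens leb mW W_ge0)).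
  - exact: RGenInftyO.measurableE.
  - move=> _ _ [a ->] [b ->]; exists (Num.min a b); apply/seteqP; split => u /=;
      by rewrite !in_itv/= lt_min => /andP.
  - by move=> k; exists k%:R.
  - apply/seteqP; split => // u _; exists (Num.bound `|u|) => //=.
    by rewrite in_itv/= (le_lt_trans (ler_norm u))// archi_boundP.
  - move=> _ [b ->]; rewrite PE /= /mdens.
    rewrite integral_mkcond.
    have [b0|b0] := leP b 0.
      rewrite (_ : _ @^-1` _ = set0) ?measure0; last first.
        apply/seteqP; split => y //=; rewrite in_itv/=.
        by rewrite ltNge (le_trans b0)// divr_ge0 ?sqr_ge0// ltW.
      rewrite integral0_eq// => u _; rewrite !patchE; case: ifPn => //.
      rewrite inE/= in_itv/= => ub; rewrite /W patchE memNset//= in_itv/= andbT.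
      by apply/negP; rewrite -leNgt (le_trans (ltW ub)).
    rewrite (_ : _ @^-1` _ = [set y | Ledist x y ^+ 2 / c < b]); last first.
      by apply/seteqP; split => y /=; rewrite in_itv.
    rewrite radial_cdf//.
    transitivity (\int[leb]_(u in `]0%R, b[) W0 u)%E; last first.
      rewrite [LHS]integral_mkcond; f_equal; apply/funext => u; rewrite /W !patchE.
      rewrite !mem_setE !in_itv/= andbT.
      by case: (u < b); rewrite ?andbT ?andbF.
    under eq_integral do rewrite /W0 EFinM.
    rewrite ge0_integralZl_EFin//=; last 3 first.
    + by move=> u _; rewrite lee_fin powR_ge0.
    + by apply/measurable_EFinP; apply: measurable_funTS; exact: measurable_powR.
    + by rewrite !mulr_ge0 ?powR_ge0// ltW.
    rewrite integral_powR_0o// -EFinM; congr EFin.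
    by field; rewrite pnatr_eq0 -lt0n.
  - move=> k; rewrite PE.
    apply: (@le_lt_trans _ _ (mu [set y | Ledist x y ^+ 2 / c < k.+1%:R])); last first.
      by rewrite radial_cdf// ltry.
    apply: le_measure; rewrite ?inE.
    + rewrite -[X in measurable X]setTI; exact: measurable_Ledist_sqr.
    + rewrite -[X in measurable X]setTI (_ : [set y | _] = (fun y => Ledist x y ^+ 2 / c) @^-1` `]-oo, k.+1%:R[%classic).
        exact: measurable_Ledist_sqr.
      by apply/seteqP; split => y /=; rewrite in_itv.
    + by move=> y /=; rewrite in_itv/= => /lt_le_trans; apply; rewrite ler_nat.
transitivity (\int[mu]_y (g (Ledist x y ^+ 2 / c)%R * 1))%E.
  by apply: eq_integral => y _; rewrite mule1.
rewrite (@ge0_integral_transfer _ _ _ _ (measurableTypeR R) R _ mu leb (cst 1%E) W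
  (fun y => Ledist x y ^+ 2 / c) id (measurable_cst _) _ mW W_ge0)//.
- rewrite [RHS]integral_mkcond; apply: eq_integral => u _.
  by rewrite /W !patchE; case: ifP => // _; rewrite mule0.
- exact: measurable_Ledist_sqr.
- move=> B mB; rewrite integral_cst ?mul1e; last first.
    rewrite -[X in measurable X]setTI; exact: measurable_Ledist_sqr.
  by rewrite -PE PW.
Qed.

End radial.

(** * Fubini and Tonelli on a rectangle, by extension by zero *)

Section fubini_in.
Local Open Scope ereal_scope.
Context d1 d2 (T1 : measurableType d1) (T2 : measurableType d2) (R : realType).
Variables (m1 : {sigma_finite_measure set T1 -> \bar R}).
Variables (m2 : {sigma_finite_measure set T2 -> \bar R}).
Variables (D1 : set T1) (D2 : set T2) (f : T1 * T2 -> \bar R).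
Hypotheses (mD1 : measurable D1) (mD2 : measurable D2).
Hypothesis mf : measurable_fun setT f.

Let g := f \_ (D1 `*` D2).

Let mg : measurable_fun setT g.
Proof.
apply/(measurable_restrictT _ _).1; first exact: measurableX.
exact: measurable_funTS.
Qed.

Let integral_y (h : \bar R -> \bar R) x : h 0 = 0 ->
  \int[m2]_y h (g (x, y)) = ((fun x => \int[m2]_(y in D2) h (f (x, y))) \_ D1) x.
Proof.
move=> h0; rewrite patchE; case: ifPn => xD1.
  rewrite [RHS]integral_mkcond; apply: eq_integral => y _.
  by rewrite /g !patchE in_setX/= xD1/=; case: ifP.
by apply: integral0_eq => y _; rewrite /g patchE in_setX/= (negbTE xD1).
Qed.

(** [h] is the identity for the iterated integrals and the absolute value for the integrability
    condition; [h 0 = 0] makes it compatible with the extension by zero. *)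
Let integral_x (h : \bar R -> \bar R) y : h 0 = 0 ->
  \int[m1]_x h (g (x, y)) = ((fun y => \int[m1]_(x in D1) h (f (x, y))) \_ D2) y.
Proof.
move=> h0; rewrite patchE; case: ifPn => yD2.
  rewrite [RHS]integral_mkcond; apply: eq_integral => x _.
  by rewrite /g !patchE in_setX/= yD2/= andbT; case: ifP.
by apply: integral0_eq => x _; rewrite /g patchE in_setX/= (negbTE yD2) andbF.
Qed.

Lemma fubini_tonelli_in : (forall z, 0 <= f z) ->
  \int[m1]_(x in D1) \int[m2]_(y in D2) f (x, y) =
  \int[m2]_(y in D2) \int[m1]_(x in D1) f (x, y).
Proof.
move=> f0; rewrite [LHS]integral_mkcond [RHS]integral_mkcond.
have g0 z : 0 <= g z by rewrite /g patchE; case: ifP.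
rewrite -(eq_integral _ _ (fun x _ => integral_y (h := id) x erefl)).
rewrite -(eq_integral _ _ (fun y _ => integral_x (h := id) y erefl)).
exact: fubini_tonelli.
Qed.

(** Absolute convergence is tested with the integral over [D1] innermost: in the applications this
    is the time integral, which is explicit. *)
Lemma fubini_in :
  \int[m2]_(y in D2) \int[m1]_(x in D1) `|f (x, y)| < +oo ->
  m1.-integrable D1 (fun x => \int[m2]_(y in D2) f (x, y)) /\
  \int[m1]_(x in D1) \int[m2]_(y in D2) f (x, y) =
  \int[m2]_(y in D2) \int[m1]_(x in D1) f (x, y).
Proof.
move=> foo.
have ig : (m1 \x m2).-integrable setT g.
  apply/(integrable21ltyP _ _ mg).
  rewrite -(eq_integral _ _ (fun y _ => esym (integral_x (h := abse) y (@abse0 R)))).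
  by rewrite -integral_mkcond.
split.
  apply/(integrable_mkcond _ mD1).
  rewrite (_ : _ \_ _ = fun x => \int[m2]_y g (x, y)); last first.
    by apply/funext => x; rewrite (integral_y (h := id)).
  exact: integrable_fubini_F ig.
rewrite [LHS]integral_mkcond [RHS]integral_mkcond.
rewrite -(eq_integral _ _ (fun x _ => integral_y (h := id) x erefl)).
rewrite -(eq_integral _ _ (fun y _ => integral_x (h := id) y erefl)).
exact: etrans (integral12_prod_meas1 ig) (esym (integral21_prod_meas1 ig)).
Qed.

End fubini_in.

Lemma ge0_integrable d (T : measurableType d) (R : realType)
    (m : {measure set T -> \bar R}) (D : set T) (f : T -> R) :
  measurable_fun D f -> (forall x, D x -> 0 <= f x) ->
  (\int[m]_(x in D) (f x)%:E < +oo)%E -> m.-integrable D (EFin \o f).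
Proof.
move=> mf f0 foo; apply/integrableP; split; first exact/measurable_EFinP.
rewrite (eq_integral (fun x => (f x)%:E))// => x /[!inE] xD.
by rewrite /= ger0_norm// f0.
Qed.

Lemma integrable_patch d (T : measurableType d) (R : realType)
    (m : {measure set T -> \bar R}) (D : set T) (f : T -> \bar R) :
  measurable D -> m.-integrable D f -> m.-integrable setT (f \_ D).
Proof. by move=> mD /integrable_mkcond; apply. Qed.

(** * Gamma integrals *)

Section gamma.
Context {R : realType}.
Local Notation leb := (@lebesgue_measure R).
Implicit Types (p q u t c a b : R).

Definition gammaf p u : R := u `^ (p - 1) * expR (- u).

Lemma gammaf_ge0 p u : 0 <= gammaf p u.
Proof. by rewrite mulr_ge0 ?powR_ge0 ?expR_ge0. Qed.

Lemma measurable_gammaf p (D : set R) : measurable_fun D (gammaf p).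
Proof.
apply: measurable_funTS; apply: measurable_funM; first exact: measurable_powR.
by apply: measurableT_comp => //; exact: measurable_expR.
Qed.

(** Raise [u / k <= expR (u / k)] to the power [k]. *)
Lemma expRN_le_powRN (k : nat) u : (0 < k)%N -> 0 < u ->
  expR (- u) <= k%:R ^+ k * u `^ (- k%:R).
Proof.
move=> k0 u0; rewrite powR_invn ?(ltW u0)// expRN.
rewrite -[leLHS]mul1r ler_pdivrMr ?expR_gt0// mulrAC ler_pdivlMr ?exprn_gt0// mul1r.
rewrite -[in expR u](@divfK _ k%:R _ u) ?pnatr_eq0 -?lt0n// expRM_natr -exprMn.
rewrite lerXn2r ?nnegrE ?(ltW u0)// ?mulr_ge0// ?expR_ge0//.
rewrite -ler_pdivrMl ?ltr0n// mulrC.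
by apply: le_trans (expR_ge1Dx _); rewrite lerDr.
Qed.

Lemma integrable_gammaf p : 0 < p -> leb.-integrable `]0, +oo[ (EFin \o gammaf p).
Proof.
(* With [k >= p + 1], the bound on [expR (- u)] leaves a power at most u^(-2) for u >= 1, while u^(p
   - 1) dominates near 0. The two intervals overlap, and the comparison switches at u = 1. *)
move=> p0; pose k := (Num.bound (p + 1)).+1.
have pk : p + 1 <= k%:R.
  have p1 : 0 <= p + 1 by rewrite addr_ge0// ltW.
  by rewrite ltW// (lt_le_trans (archi_boundP p1))// ler_nat.
pose C : R := k%:R ^+ k.
have i1 : leb.-integrable setT ((EFin \o (fun u => u `^ (p - 1))) \_ `]0, 2[).
  apply: (@integrable_patch _ (measurableTypeR R)) => //.
  apply: (@ge0_integrable _ (measurableTypeR R) R leb `]0, 2[ (fun u => u `^ (p - 1))) => //.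
  - by apply: measurable_funTS; exact: measurable_powR.
  - by move=> u _; exact: powR_ge0.
  - by rewrite integral_powR_0o// ltry.
have i2 : leb.-integrable setT ((EFin \o (fun u => u `^ (- 1 - 1))) \_ `]2^-1, +oo[).
  apply: (@integrable_patch _ (measurableTypeR R)) => //.
  apply: (@ge0_integrable _ (measurableTypeR R) R leb `]2^-1, +oo[ (fun u => u `^ (- 1 - 1))) => //.
  - by apply: measurable_funTS; exact: measurable_powR.
  - by move=> u _; exact: powR_ge0.
  - by rewrite integral_powR_oy// ltry.
have i12 := integrableD measurableT i1 (integrableZl measurableT C i2).
rewrite (@integrable_mkcond _ (measurableTypeR R))//.
apply: (le_integrable measurableT _ _ i12).
  apply/(measurable_restrictT _ _).1 => //.
  by apply/measurable_EFinP; exact: measurable_gammaf.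
move=> u _ /=; rewrite !patchE /= !mem_setE !in_itv/= !andbT.
have [u0|u0] := ltP 0 u; last first.
  by rewrite abse0.
have [u1|u1] := ltP u 1.
  rewrite (lt_trans u1) ?ltr1n// gee0_abs ?lee_fin ?gammaf_ge0// gee0_abs; last first.
    by rewrite adde_ge0 ?lee_fin ?powR_ge0//; case: ifP => _; rewrite ?mule0// -EFinM lee_fin mulr_ge0 ?powR_ge0// exprn_ge0.
  apply: (@le_trans _ _ (u `^ (p - 1))%:E); last first.
    by rewrite leeDl//; case: ifP => _; rewrite ?mule0// -EFinM lee_fin mulr_ge0 ?powR_ge0// exprn_ge0.
  by rewrite lee_fin ler_piMr ?powR_ge0// expR_le1 oppr_le0 ltW.
rewrite (lt_le_trans _ u1) ?invf_lt1 ?ltr1n// gee0_abs ?lee_fin ?gammaf_ge0// gee0_abs; last first.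
  by rewrite adde_ge0//; [case: ifP => _; rewrite ?lee_fin ?powR_ge0|rewrite -EFinM lee_fin mulr_ge0 ?powR_ge0// exprn_ge0].
apply: (@le_trans _ _ (C * u `^ (- 1 - 1))%:E); last first.
  by rewrite EFinM leeDr//; case: ifP => _; rewrite ?lee_fin ?powR_ge0.
rewrite lee_fin /gammaf; apply: (@le_trans _ _ (u `^ (p - 1) * (C * u `^ (- k%:R)))).
  by rewrite ler_wpM2l ?powR_ge0// expRN_le_powRN.
rewrite mulrCA ler_wpM2l ?exprn_ge0//.
rewrite -powRD; last by rewrite (gt_eqF u0) implybT.
by apply: ler_powR => //; lra.
Qed.

Lemma integral_gammaf p : 0 < p ->
  (\int[leb]_(u in `]0%R, +oo[) (gammaf p u)%:E = (LGamma p)%:E)%E.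
Proof.
move=> p0; rewrite fineK//.
by apply: (@integrable_fin_num _ (measurableTypeR R)) => //; exact: integrable_gammaf.
Qed.

Lemma ge0_integralZl_leb k (f : R -> R) (D : set R) : 0 <= k ->
  (forall u, 0 <= f u) -> measurable_fun setT f -> measurable D ->
  (\int[leb]_(u in D) (k%:E * (f u)%:E) = k%:E * \int[leb]_(u in D) (f u)%:E)%E.
Proof.
move=> k0 f0 mf mD.
apply: (@ge0_integralZl_EFin _ (measurableTypeR R) R leb D mD (EFin \o f)) => //.
  by move=> u _; rewrite lee_fin f0.
by apply/measurable_EFinP; exact: measurable_funTS.
Qed.

Let mexpN : measurable_fun setT (fun v : R => expR (- v)).
Proof. by apply: (measurableT_comp (@measurable_expR R)). Qed.

Let mind2 (h : R * R -> bool) (f : R * R -> R) :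
  measurable_fun setT h -> measurable_fun setT f ->
  measurable_fun setT (fun z => (if h z then f z else 0)%:E).
Proof.
by move=> mh mf; apply/measurable_EFinP; exact: measurable_fun_ifT.
Qed.

Let mprod q : measurable_fun setT (fun z : R * R => z.1 `^ (q - 1) * expR (- z.2)).
Proof.
apply: measurable_funM.
  by apply: (measurableT_comp (measurable_powR _)); exact: measurable_fst.
apply: (measurableT_comp (@measurable_expR R)).
by apply: measurableT_comp => //; exact: measurable_snd.
Qed.

(** Integrate u^(q - 1) e^(-v) over 0 < u < v in both orders: the inner integral in v leaves
    Gamma(q), the inner integral in u leaves Gamma(q + 1) / q. *)
Lemma LGammaS q : 0 < q -> LGamma (q + 1) = q * LGamma q.
Proof.
move=> q0; apply: EFin_inj; rewrite EFinM -!integral_gammaf ?addr_gt0//.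
pose f (z : R * R) : \bar R := (if z.1 < z.2 then z.1 `^ (q - 1) * expR (- z.2) else 0)%:E.
have mf : measurable_fun setT f.
  have mh : measurable_fun setT (fun z : R * R => z.1 < z.2) by exact: measurable_fun_ltr.
  exact: (mind2 mh (mprod q)).
have f0 z : (0 <= f z)%E.
  by rewrite /f; case: ifP => _; rewrite lee_fin// mulr_ge0 ?powR_ge0 ?expR_ge0.
have E : (\int[leb]_(t in `]0%R, +oo[) \int[leb]_(u in `]0%R, +oo[) f (t, u) =
   \int[leb]_(u in `]0%R, +oo[) \int[leb]_(t in `]0%R, +oo[) f (t, u))%E.
  by apply: (@fubini_tonelli_in _ _ (measurableTypeR R) (measurableTypeR R)).
have E1 : (\int[leb]_(u in `]0%R, +oo[) \int[leb]_(v in `]0%R, +oo[) f (u, v) =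
    \int[leb]_(u in `]0%R, +oo[) (gammaf q u)%:E)%E.
  apply: eq_integral => u; rewrite inE/= in_itv/= andbT => u0.
  transitivity (\int[leb]_(v in `]u, +oo[) ((u `^ (q - 1))%:E * (expR (- v))%:E))%E.
    rewrite integral_mkcond [RHS]integral_mkcond; apply: eq_integral => v _.
    rewrite !patchE !mem_setE !in_itv/= !andbT /f/=; case: (ltP u v) => uv; last by case: ifP.
    by rewrite (lt_trans u0 uv) EFinM.
  rewrite (ge0_integralZl_leb (powR_ge0 _ _) (fun v => expR_ge0 (- v)) mexpN (measurable_itv _)).
  by rewrite integral_expRN_oy ?EFinM.
rewrite -E1 E.
have -> : (\int[leb]_(v in `]0%R, +oo[) \int[leb]_(u in `]0%R, +oo[) f (u, v) =
    q^-1%:E * \int[leb]_(v in `]0%R, +oo[) (gammaf (q + 1) v)%:E)%E.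
  have qV0 : 0 <= q^-1 by rewrite invr_ge0 ltW.
  rewrite -(ge0_integralZl_leb qV0 (gammaf_ge0 (q + 1)) (@measurable_gammaf (q + 1) setT) (measurable_itv _)).
  apply: eq_integral => v; rewrite inE/= in_itv/= andbT => v0.
  transitivity (\int[leb]_(u in `]0%R, v[) ((expR (- v))%:E * (u `^ (q - 1))%:E))%E.
    rewrite integral_mkcond [RHS]integral_mkcond; apply: eq_integral => u _.
    rewrite !patchE !mem_setE !in_itv/= !andbT /f/=; case: (ltP u v) => uv; last by rewrite andbF; case: ifP.
    by rewrite andbT mulrC EFinM.
  rewrite (ge0_integralZl_leb (expR_ge0 _) (fun v => powR_ge0 v _) (measurable_powR _) (measurable_itv _)).
  rewrite (integral_powR_0o q0 v0) -!EFinM /gammaf addrK; congr EFin.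
  ring.
have q_neq0 : q != 0 by rewrite gt_eqF.
by rewrite muleA -EFinM (divff q_neq0) mul1e.
Qed.

(** Write e^(-c/t) as the integral of e^(-v) over v > c / t and exchange the integrals: the integral
    of t^(-q-1) over t > c / v is (c / v)^(-q) / q, and Gamma(q + 1) / q = Gamma(q). This replaces
    the substitution u = c / t. *)
Lemma integral_powR_expRN_inv q c : 0 < q -> 0 < c ->
  (\int[leb]_(t in `]0%R, +oo[) (t `^ (- q - 1) * expR (- (c / t)))%:E =
   (c `^ (- q) * LGamma q)%:E)%E.
Proof.
move=> q0 c0.
pose f (z : R * R) : \bar R := (if c < z.1 * z.2 then z.1 `^ (- q - 1) * expR (- z.2) else 0)%:E.
have mf : measurable_fun setT f.
  have mh : measurable_fun setT (fun z : R * R => c < z.1 * z.2).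
    by apply: measurable_fun_ltr => //; exact: measurable_funM.
  exact: (mind2 mh (mprod (- q))).
have f0 z : (0 <= f z)%E.
  by rewrite /f; case: ifP => _; rewrite lee_fin// mulr_ge0 ?powR_ge0 ?expR_ge0.
have E : (\int[leb]_(t in `]0%R, +oo[) \int[leb]_(u in `]0%R, +oo[) f (t, u) =
   \int[leb]_(u in `]0%R, +oo[) \int[leb]_(t in `]0%R, +oo[) f (t, u))%E.
  by apply: (@fubini_tonelli_in _ _ (measurableTypeR R) (measurableTypeR R)).
have E1 : (\int[leb]_(t in `]0%R, +oo[) \int[leb]_(v in `]0%R, +oo[) f (t, v) =
    \int[leb]_(t in `]0%R, +oo[) (t `^ (- q - 1) * expR (- (c / t)))%:E)%E.
  apply: eq_integral => t; rewrite inE/= in_itv/= andbT => t0.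
  have ct0 : 0 < c / t by rewrite divr_gt0.
  transitivity (\int[leb]_(v in `](c / t)%R, +oo[) ((t `^ (- q - 1))%:E * (expR (- v))%:E))%E.
    rewrite integral_mkcond [RHS]integral_mkcond; apply: eq_integral => v _.
    rewrite !patchE !mem_setE !in_itv/= !andbT /f/= (ltr_pdivrMr _ _ t0) [v * t]mulrC.
    case: (ltP c (t * v)) => uv; last by case: ifP.
    by rewrite -(pmulr_rgt0 _ t0) (lt_trans c0 uv) EFinM.
  have Z := ge0_integralZl_leb (powR_ge0 t (- q - 1)) (fun v => expR_ge0 (- v)) mexpN (measurable_itv `](c / t), +oo[).
  rewrite Z.
  by rewrite integral_expRN_oy EFinM.
rewrite -E1 E.
have -> : (\int[leb]_(v in `]0%R, +oo[) \int[leb]_(u in `]0%R, +oo[) f (u, v) =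
    (c `^ (- q) / q)%:E * \int[leb]_(v in `]0%R, +oo[) (gammaf (q + 1) v)%:E)%E.
  have cq0 : 0 <= c `^ (- q) / q by apply: divr_ge0; [exact: powR_ge0|exact: ltW].
  rewrite -(ge0_integralZl_leb cq0 (gammaf_ge0 (q + 1)) (@measurable_gammaf (q + 1) setT) (measurable_itv _)).
  apply: eq_integral => v; rewrite inE/= in_itv/= andbT => v0.
  have cv0 : 0 < c / v by rewrite divr_gt0.
  transitivity (\int[leb]_(u in `](c / v)%R, +oo[) ((expR (- v))%:E * (u `^ (- q - 1))%:E))%E.
    rewrite integral_mkcond [RHS]integral_mkcond; apply: eq_integral => u _.
    rewrite !patchE !mem_setE !in_itv/= !andbT /f/= (ltr_pdivrMr _ _ v0).
    case: (ltP c (u * v)) => uv; last by case: ifP.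
    by rewrite -(pmulr_lgt0 _ v0) (lt_trans c0 uv) mulrC EFinM.
  rewrite (ge0_integralZl_leb (expR_ge0 (- v)) (fun u => powR_ge0 u (- q - 1)) (measurable_powR (- q - 1)) (measurable_itv `](c / v), +oo[)).
  rewrite (integral_powR_oy q0 cv0) -!EFinM /gammaf addrK; congr EFin.
  have -> : (c / v) `^ (- q) = c `^ (- q) * v `^ q.
    rewrite (powRM _ (ltW c0)); last by rewrite invr_ge0 ltW.
    by rewrite -(powR_inv1 (ltW v0)) -powRrM mulN1r opprK.
  ring.
rewrite (integral_gammaf (addr_gt0 q0 ltr01)) (LGammaS q0) -EFinM; congr EFin; field.
by rewrite gt_eqF.
Qed.

End gamma.

(** * Logarithms against Gamma densities, and the derivative of Gamma *)

Section log_gamma.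
Context {R : realType}.
Local Notation leb := (@lebesgue_measure R).
Implicit Types (p q u t c a b s : R).

(** The inequality [ln v < v] with v = u^e bounds the logarithm from above, and with v = u^(-e) from
    below. *)
Lemma norm_ln_le e u : 0 < e -> 0 < u -> `|ln u| <= e^-1 * (u `^ e + u `^ (- e)).
Proof.
move=> e0 u0; rewrite ler_norml mulrDr; apply/andP; split.
  rewrite lerNl -lerBlDl.
  have : ln (u `^ (- e)) <= u `^ (- e) by apply/ltW/ln_sublinear; exact: powR_gt0.
  rewrite ln_powR mulNr -mulrN mulrC -ler_pdivlMr// => h.
  apply: (@le_trans _ _ (- ln u)); first by rewrite gerBl mulr_ge0 ?powR_ge0// invr_ge0 ltW.
  by rewrite mulrC.
have : ln (u `^ e) <= u `^ e by apply/ltW/ln_sublinear; exact: powR_gt0.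
rewrite ln_powR mulrC -ler_pdivlMr// => h.
by rewrite (le_trans h)// mulrC lerDl mulr_ge0 ?powR_ge0// invr_ge0 ltW.
Qed.

(** The power with exponent [b - 1] dominates for [u >= 1], the one with exponent [a - 1] for
    [u <= 1]. *)
Lemma gammaf_le a b p u : 0 < u -> a <= p -> p <= b -> gammaf p u <= gammaf a u + gammaf b u.
Proof.
move=> u0 ap pb; rewrite /gammaf -mulrDl ler_wpM2r ?expR_ge0//.
have [u1|u1] := leP 1 u.
  by rewrite (@le_trans _ _ (u `^ (b - 1)))// ?lerDr ?powR_ge0//; apply: ler_powR => //; rewrite lerD2r.
rewrite (@le_trans _ _ (u `^ (a - 1)))// ?lerDl ?powR_ge0//; apply: ger_powR; last by rewrite lerD2r.
by rewrite u0 ltW.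
Qed.

(** A bound for [ln u * gammaf s u], uniform in [s] between p / 2 and 3 p / 2: by [norm_ln_le] with
    e = p / 4 the logarithm shifts the parameter to s - p / 4 or s + p / 4, and both lie between p /
    4 and 2 p. *)
Let dom p u : R := (p / 4)^-1 * (2 * (gammaf (p / 4) u + gammaf (2 * p) u)).

Let dom_ub p s u : 0 < p -> p / 2 < s -> s < 3 / 2 * p -> 0 < u ->
  `|ln u * gammaf s u| <= dom p u.
Proof.
move=> p0 ps sp u0.
have e0 : 0 < p / 4 by rewrite divr_gt0.
rewrite normrM (ger0_norm (gammaf_ge0 _ _)).
apply: (@le_trans _ _ ((p / 4)^-1 * (gammaf (s + p / 4) u + gammaf (s - p / 4) u))).
  rewrite /gammaf -mulrDl mulrA [X in _ <= X]mulrA ler_wpM2r ?expR_ge0//.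
  apply: (le_trans (ler_wpM2r (powR_ge0 _ _) (norm_ln_le e0 u0))).
  rewrite -mulrA ler_wpM2l ?invr_ge0 ?(ltW e0)// mulrDl -!powRD ?(gt_eqF u0) ?implybT//.
  by rewrite le_eqVlt; apply/orP; left; apply/eqP; congr (_ + _); congr powR; ring.
rewrite ler_wpM2l ?invr_ge0 ?(ltW e0)// mulr_natl mulr2n.
by apply: lerD; apply: gammaf_le => //; lra.
Qed.

Let dom_ge0 p (p0 : 0 < p) u : 0 <= dom p u.
Proof.
by rewrite mulr_ge0 ?invr_ge0 ?divr_ge0 ?(ltW p0)// mulr_ge0// addr_ge0// gammaf_ge0.
Qed.

Let integrable_dom p : 0 < p -> leb.-integrable `]0, +oo[ (EFin \o dom p).
Proof.
move=> p0.
have ia : leb.-integrable `]0, +oo[ (EFin \o gammaf (p / 4)) by apply: integrable_gammaf; rewrite divr_gt0.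
have ib : leb.-integrable `]0, +oo[ (EFin \o gammaf (2 * p)) by apply: integrable_gammaf; rewrite mulr_gt0.
have := @integrableZl _ (measurableTypeR R) R leb `]0, +oo[ (measurable_itv _) ((p / 4)^-1 * 2) _
  (@integrableD _ (measurableTypeR R) R leb `]0, +oo[ (measurable_itv _) _ _ ia ib).
by apply: eq_integrable => // u _; rewrite /= -EFinD -EFinM /dom mulrA.
Qed.

Lemma integrable_ln_gammaf p : 0 < p ->
  leb.-integrable `]0, +oo[ (EFin \o (fun u => ln u * gammaf p u)).
Proof.
move=> p0; apply: (@le_integrable _ (measurableTypeR R) R leb `]0, +oo[ (measurable_itv _) _ _ _ _ (integrable_dom p0)).
  apply/measurable_EFinP; apply: measurable_funM; last exact: measurable_gammaf.
  by apply: measurable_funTS; exact: measurable_ln.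
move=> u /=; rewrite in_itv/= andbT => u0; rewrite lee_fin [leRHS]ger0_norm ?dom_ge0//.
by apply: dom_ub => //; lra.
Qed.

Let is_derive_gammaf s u : 0 < u ->
  is_derive s 1 (fun s => gammaf s u) (ln u * gammaf s u).
Proof.
move=> u0.
have -> : (fun s => gammaf s u) = expR (- u) \*: (fun s => expR ((s - 1) * ln u)).
  by apply/funext => s'; rewrite /gammaf /powR gt_eqF// mulrC.
have h : is_derive ((s - 1) * ln u) 1 expR (expR ((s - 1) * ln u)) by exact: is_derive_expR.
have h2 : is_derive s 1 (fun s => (s - 1) * ln u) (ln u).
  have -> : (fun s => (s - 1) * ln u) = ln u \*: (id - cst 1).
    by apply/funext => s'; rewrite /= mulrC.
  by apply: is_derive_eq; rewrite subr0 /GRing.scale/= mulr1.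
have h3 := @is_derive1_comp R expR (fun s => (s - 1) * ln u) s _ _ h h2.
apply: (is_derive_eq (is_deriveZ _ h3)).
by rewrite /gammaf /powR gt_eqF//; rewrite /GRing.scale/=; ring.
Qed.

(** Differentiation under the integral sign; on the neighbourhood of [p] from p / 2 to 3 p / 2 the
    derivative in the parameter is dominated by [dom p]. *)
Lemma derive1_LGamma p : 0 < p ->
  (\int[leb]_(u in `]0%R, +oo[) (ln u * gammaf p u)%:E = (derive1 (@LGamma R) p)%:E)%E.
Proof.
move=> p0.
have pI : p \in `]p / 2, (3 / 2 * p)[ by rewrite in_itv/=; apply/andP; split; lra.
have := @differentiation_under_integral R _ (measurableTypeR R) leb (fun s u => gammaf s u)
  `]0, +oo[ (measurable_itv _) p (p / 2) (3 / 2 * p) pI.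
rewrite -/(@LGamma R) => H.
have H1 s : `]p / 2, (3 / 2 * p)[%classic s -> leb.-integrable `]0, +oo[ (EFin \o gammaf s).
  by rewrite /= in_itv/= => /andP[ps _]; apply: integrable_gammaf; lra.
have H2 s u : `]p / 2, (3 / 2 * p)[%classic s -> `]0, +oo[%classic u ->
    derivable (fun s => gammaf s u) s 1.
  by move=> _; rewrite /= in_itv/= andbT => u0; have [] := is_derive_gammaf s u0.
have H3 s u : `]p / 2, (3 / 2 * p)[%classic s -> `]0, +oo[%classic u ->
    `|partial1of2 (fun s u => gammaf s u) s u| <= dom p u.
  rewrite /= !in_itv/= andbT => /andP[ps sp] u0.
  have dg := is_derive_gammaf s u0; rewrite partial1of2E derive_val.
  exact: dom_ub.
rewrite (H H1 H2 (dom p) (dom_ge0 p0) (integrable_dom p0) H3).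
rewrite -(@fineK _ (\int[leb]_(u in _) _)%E); last first.
  by apply: (@integrable_fin_num _ (measurableTypeR R)) => //; exact: integrable_ln_gammaf.
congr EFin; apply: eq_Rintegral => u; rewrite inE/= in_itv/= andbT => u0.
by have dg := is_derive_gammaf p u0; rewrite partial1of2E derive_val.
Qed.

(* Integrating [jump c t] against dt/t gives [ln c]; this turns e^{-t} and the heat
   content of the unit ball into logarithmic moments of gamma densities. *)
Definition jump c t : R := (if t < c then 1 else 0) - (if t < 1 then 1 else 0).

(** Up to sign, [jump c] is the indicator of the interval between [c] and 1, so it does not change
    sign. The identity for the absolute value supplies the integrability that Fubini asks for. *)
Lemma integral_jump c : 0 < c ->
  (\int[leb]_(t in `]0%R, +oo[) (jump c t / t)%:E = (ln c)%:E)%E /\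
  (\int[leb]_(t in `]0%R, +oo[) `|jump c t / t|%:E = `|ln c|%:E)%E.
Proof.
move=> c0.
have H a b : 0 < a -> a <= b -> (\int[leb]_(t in `]0%R, +oo[)
    (if a <= t < b then t^-1 else 0)%:E = (ln b - ln a)%:E)%E.
  move=> a0 ab; rewrite -integral_inv_oo//.
  rewrite -(@integral_itv_bndoo _ a b (fun t => (t^-1)%:E) true true); last first.
    apply/measurable_EFinP; apply: open_continuous_measurable_fun => //.
    move=> t; rewrite inE/= in_itv/= => /andP[at' _]; apply: continuousV => //.
    by rewrite gt_eqF// (lt_trans a0).
  rewrite integral_mkcond [RHS]integral_mkcond; apply: eq_integral => t _.
  rewrite !patchE !mem_setE !in_itv/= andbT; case: (leP a t) => at' /=; last by case: ifP.
  by rewrite (lt_le_trans a0 at'); case: ifP.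
have [c1|c1] := leP c 1.
  have JE t : jump c t / t = - (if c <= t < 1 then t^-1 else 0).
    rewrite /jump; have [tc|ct] := ltP t c.
      by rewrite (lt_le_trans tc c1) subrr mul0r oppr0.
    by case: ifP => _; [rewrite sub0r mulN1r|rewrite subr0 mul0r oppr0].
  have Jge0 t : 0 < t -> 0 <= (if c <= t < 1 then t^-1 else 0).
    by move=> t0; case: ifP => // _; rewrite invr_ge0 ltW.
  split.
    under eq_integral do rewrite JE EFinN.
    rewrite integral_ge0N; last first.
      by move=> t /=; rewrite in_itv/= andbT => t0; rewrite lee_fin Jge0.
    by rewrite H// ln1 sub0r EFinN oppeK.
  transitivity (\int[leb]_(t in `]0%R, +oo[) (if (c <= t < 1)%R then t^-1 else 0)%:E)%E.
    by apply: eq_integral => t; rewrite inE/= in_itv/= andbT => t0; rewrite JE /= normrN ger0_norm// Jge0.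
  by rewrite H// ln1 sub0r ler0_norm// ln_le0.
have JE t : jump c t / t = (if 1 <= t < c then t^-1 else 0).
  rewrite /jump; have [t1|t1] := ltP t 1.
    by rewrite (lt_trans t1 c1) subrr mul0r.
  by case: ifP => _; [rewrite subr0 mul1r|rewrite subr0 mul0r].
have Jge0 t : 0 < t -> 0 <= (if 1 <= t < c then t^-1 else 0).
  by move=> t0; case: ifP => // _; rewrite invr_ge0 ltW.
split.
  under eq_integral do rewrite JE.
  by rewrite H// ?ln1 ?subr0// ltW.
transitivity (\int[leb]_(t in `]0%R, +oo[) (if (1 <= t < c)%R then t^-1 else 0)%:E)%E.
  by apply: eq_integral => t; rewrite inE/= in_itv/= andbT => t0; rewrite JE /= ger0_norm// Jge0.
by rewrite H// ?(ltW c1)// ln1 subr0 ger0_norm// ln_ge0// ltW.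
Qed.

Lemma measurable_invr : measurable_fun setT (fun t : R => t^-1).
Proof.
(* Inversion is expressed by real powers on either side of 0; at 0 the convention is [0^-1 = 0]. *)
rewrite (_ : (fun t => t^-1) = fun t => if t == 0 then 0 else if 0 < t then t `^ (-1) else - ((- t) `^ (-1))).
  apply: measurable_fun_ifT => //.
    by apply: measurable_fun_eqr.
  apply: measurable_fun_ifT => //;
    first [exact: measurable_fun_ltr|exact: measurable_powR|
      by apply: measurableT_comp => //; apply: (measurableT_comp (measurable_powR _))].
apply/funext => t; case: ifPn => [/eqP ->|t0]; first by rewrite invr0.
case: ltP => t1; first by rewrite powR_inv1 ?ltW.
by rewrite powR_inv1 ?oppr_ge0// invrN opprK.
Qed.

Lemma measurable_jump c : measurable_fun setT (fun t => jump c t / t).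
Proof.
apply: measurable_funM; last exact: measurable_invr.
by apply: measurable_funB; apply: measurable_fun_ifT => //; exact: measurable_fun_ltr.
Qed.

(** Fubini with time innermost: by [integral_jump] the inner absolute integral is
    [|ln (phi u)| * w u], so absolute convergence is the integrability of [ln (phi u) * w u]. For a
    probability density [w] the value is the mean of ln phi. *)
Lemma integral_log_mean (phi w : R -> R) :
  measurable_fun setT phi -> measurable_fun setT w ->
  (forall u, 0 < u -> 0 < phi u) -> (forall u, 0 <= w u) ->
  leb.-integrable `]0, +oo[ (EFin \o (fun u => ln (phi u) * w u)) ->
  leb.-integrable `]0, +oo[
    (fun t => \int[leb]_(u in `]0%R, +oo[) (jump (phi u) t / t * w u)%:E)%E /\
  (\int[leb]_(t in `]0%R, +oo[) \int[leb]_(u in `]0%R, +oo[) (jump (phi u) t / t * w u)%:E =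
   \int[leb]_(u in `]0%R, +oo[) (ln (phi u) * w u)%:E)%E.
Proof.
move=> mphi mw phi0 w0 il.
pose f (z : R * R) : \bar R := (jump (phi z.2) z.1 / z.1 * w z.2)%:E.
have mphi2 : measurable_fun setT (fun z : R * R => phi z.2) by apply: measurableT_comp.
have mJ : measurable_fun setT (fun z : R * R => jump (phi z.2) z.1).
  by apply: measurable_funB; apply: measurable_fun_ifT => //; exact: measurable_fun_ltr.
have mf : measurable_fun setT f.
  apply/measurable_EFinP; apply: measurable_funM; last by apply: measurableT_comp.
  by apply: measurable_funM => //; apply: (measurableT_comp measurable_invr).
have foo : (\int[leb]_(u in `]0%R, +oo[) \int[leb]_(t in `]0%R, +oo[) `|f (t, u)| < +oo)%E.
  suff -> : (\int[leb]_(u in `]0%R, +oo[) \int[leb]_(t in `]0%R, +oo[) `|f (t, u)| =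
      \int[leb]_(u in `]0%R, +oo[) `|(ln (phi u) * w u)%:E|)%E.
    by have /integrableP[] := il.
  apply: eq_integral => u; rewrite inE/= in_itv/= andbT => u0.
  transitivity (\int[leb]_(t in `]0%R, +oo[) ((w u)%:E * `|jump (phi u) t / t|%:E))%E.
    by apply: eq_integral => t _; rewrite /f/= -EFinM normrM (ger0_norm (w0 u)) mulrC.
  rewrite (ge0_integralZl_leb (w0 u) _ _ (measurable_itv _)); last 2 first.
  - by move=> t; exact: normr_ge0.
  - by apply: measurableT_comp => //; exact: measurable_jump.
  rewrite [X in (_ * X)%E](_ : _ = `|ln (phi u)|%:E)%E; last exact: (integral_jump (phi0 _ u0)).2.
  rewrite -EFinM /= normrM (ger0_norm (w0 u)).
  by rewrite mulrC.
have [i1 e1] := @fubini_in _ _ (measurableTypeR R) (measurableTypeR R) R leb leb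
  `]0, +oo[ `]0, +oo[ f (measurable_itv _) (measurable_itv _) mf foo.
split => //; rewrite e1; apply: eq_integral => u; rewrite inE/= in_itv/= andbT => u0.
rewrite /f/=; under eq_integral do rewrite EFinM.
rewrite (@integralZr _ (measurableTypeR R) R leb `]0, +oo[ (measurable_itv _) (EFin \o (fun t => jump (phi u) t / t))).
  by rewrite (integral_jump (phi0 _ u0)).1 -EFinM.
apply/integrableP; split.
  by apply/measurable_EFinP; apply: measurable_funTS; exact: measurable_jump.
rewrite [X in (X < _)%E](_ : _ = `|ln (phi u)|%:E)%E ?ltry//.
exact: (integral_jump (phi0 _ u0)).2.
Qed.

End log_gamma.

(** * Hoelder functions of compact support, and sigma-finiteness of Lebesgue measure *)

Section holder.
Context (R : realType) (n : nat).
Implicit Types (f : n.-tuple R -> R) (x y : n.-tuple R) (a : R).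

Lemma LedistC x y : Ledist x y = Ledist y x.
Proof. by rewrite /Ledist; congr Num.sqrt; apply: eq_bigr => i _; rewrite -sqrrN opprB. Qed.

Lemma Lhoelder_ge0 a f : Lhoelder a f ->
  exists2 C, 0 < C & forall x y, `|f x - f y| <= C * Ledist x y `^ a.
Proof.
move=> [C HC]; exists (`|C| + 1); first by rewrite ltr_wpDl.
move=> x y; apply: (le_trans (HC x y)); rewrite ler_wpM2r ?powR_ge0//.
by rewrite (le_trans (ler_norm C))// lerDl.
Qed.

Lemma exists_rat_tuple_near y (e : R) : 0 < e ->
  exists r : n.-tuple rat, Ledist y (map_tuple ratr r) < e.
Proof.
move=> e0.
(* If each of the [n] coordinates is off by less than [d], the squared distance is at most n e^2 /
   (n + 1)^2 < e^2; the denominator n + 1 also covers n = 0. *)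
pose d := e / (n.+1%:R).
have d0 : 0 < d by rewrite divr_gt0.
have H i : exists s : rat, `|tnth y i - ratr s| < d.
  have : tnth y i - d < tnth y i + d by rewrite ltrD2l gtrN.
  move=> /rat_in_itvoo[s]; rewrite in_itv/= => /andP[s1 s2]; exists s.
  by rewrite ltr_distlC s1 s2.
have [r rP] := choice H.
exists [tuple r i | i < n].
rewrite -(@ltr_pXn2r _ 2) ?nnegrE ?sqrtr_ge0 ?(ltW e0)// Ledist_sqr.
apply: (@le_lt_trans _ _ (\sum_(i < n) d ^+ 2)).
  apply: ler_sum => i _; rewrite tnth_map tnth_mktuple -real_normK ?num_real//.
  by rewrite lerXn2r ?nnegrE// ?(ltW d0)// ltW.
rewrite sumr_const card_ord -mulr_natl /d expr_div_n mulrCA gtr_pMr ?exprn_gt0//.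
rewrite ltr_pdivrMr ?exprn_gt0// mul1r -natrX ltr_nat.
by rewrite expnS expn1 (leq_trans (ltnSn n))// leq_pmulr.
Qed.

(* By density, [f y < c] iff [f r + C * |r - y| ^ a < c] for some rational [r]. *)
Lemma measurable_Lhoelder a f : 0 < a -> Lhoelder a f -> measurable_fun setT f.
Proof.
move=> a0 /Lhoelder_ge0[C C0 HC].
pose g (r : n.-tuple rat) y := f (map_tuple ratr r) + C * Ledist (map_tuple ratr r) y `^ a.
have mg r : measurable_fun setT (g r).
  apply: measurable_funD => //; apply: measurable_funM => //.
  by apply: (measurableT_comp (measurable_powR _)); exact: measurable_Ledist.
apply: (measurability (@RGenInftyO.G R)); first exact: RGenInftyO.measurableE.
move=> _ [_ [c ->] <-]; rewrite setTI.
rewrite (_ : _ @^-1` _ = \bigcup_(r in [set: n.-tuple rat]) (g r @^-1` `]-oo, c[%classic)).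
  apply: countable_bigcupT_measurable => [|r]; first exact: countableP.
  rewrite -[X in measurable X]setTI; exact: mg.
apply/seteqP; split => y /=; rewrite in_itv/=; last first.
  move=> [r _] /=; rewrite in_itv/=; apply: le_lt_trans.
  by rewrite /g -lerBlDl; apply: le_trans (ler_norm _) _; rewrite LedistC; exact: HC.
move=> fc.
(* This radius e solves C e^a = (c - f y) / 2: one half pays for f r - f y, the other for the term C
   |r - y|^a of [g]. *)
have e0 : 0 < ((c - f y) / (2 * C)) `^ a^-1.
  by rewrite powR_gt0// divr_gt0 ?subr_gt0// mulr_gt0.
have [r yr] := exists_rat_tuple_near y e0; exists r => //=; rewrite in_itv/= /g.
have h : C * Ledist (map_tuple ratr r) y `^ a < (c - f y) / 2.
  rewrite mulrC -ltr_pdivlMr// -mulrA -invfM LedistC.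
  rewrite (_ : (c - f y) / (2 * C) = (((c - f y) / (2 * C)) `^ a^-1) `^ a); last first.
    by rewrite -powRrM mulVf ?gt_eqF// powRr1// divr_ge0 ?subr_ge0 ?(ltW fc)// mulr_ge0// ltW.
  by apply: gt0_ltr_powR => //; rewrite ?nnegrE ?sqrtr_ge0// ltW.
have := HC (map_tuple ratr r) y; move=> /(le_trans (ler_norm _)) h2.
by move: h h2; set z := C * _; lra.
Qed.

Lemma Ledist_sqr_le x y : Ledist x y ^+ 2 <= 2 * Lenorm x ^+ 2 + 2 * Lenorm y ^+ 2.
Proof.
rewrite Ledist_sqr /Lenorm !sqr_sqrtr ?sumr_ge0//; try by move=> i _; exact: sqr_ge0.
rewrite !mulr_sumr -big_split/=; apply: ler_sum => i _.
set u := tnth x i; set v := tnth y i.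
by have := sqr_ge0 (u + v); rewrite -subr_ge0 => h; rewrite -subr_ge0; nra.
Qed.

Lemma compact_support_far f x : Lhas_compact_support f ->
  exists2 rho, 1 <= rho & forall y, rho <= Ledist x y -> f y = 0.
Proof.
(* Derived from |x - y|^2 <= 2 |x|^2 + 2 |y|^2. The summand 1 makes the distance at least 1, hence
   at most its square, and makes the contradiction strict. *)
move=> [M HM]; exists (2 * Lenorm x ^+ 2 + 2 * M ^+ 2 + 1).
  by rewrite lerDr addr_ge0// mulr_ge0// sqr_ge0.
move=> y xy; apply: HM; rewrite ltNge; apply/negP => yM.
have r1 : 1 <= Ledist x y by apply: le_trans xy; rewrite lerDr addr_ge0// mulr_ge0// sqr_ge0.
have h1 : Ledist x y <= Ledist x y ^+ 2 by rewrite expr2 ler_peMl// (le_trans ler01).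
have h2 := Ledist_sqr_le x y.
have h3 : Lenorm y ^+ 2 <= M ^+ 2.
  by rewrite lerXn2r ?nnegrE ?sqrtr_ge0// (le_trans (sqrtr_ge0 _) yM).
lra.
Qed.

Lemma Lhoelder_bounded a f : 0 < a -> Lhas_compact_support f -> Lhoelder a f ->
  exists2 B, 0 <= B & forall y, `|f y| <= B.
Proof.
move=> a0 cf /Lhoelder_ge0[C C0 HC].
pose o : n.-tuple R := [tuple 0 | i < n].
have [rho rho1 Hrho] := compact_support_far o cf.
exists (`|f o| + C * rho `^ a); first by rewrite addr_ge0// mulr_ge0 ?powR_ge0// ltW.
move=> y; have [oy|oy] := leP rho (Ledist o y).
  by rewrite Hrho// normr0 addr_ge0// mulr_ge0 ?powR_ge0// ltW.
rewrite -[f y](subrK (f o)) addrC (le_trans (ler_normD _ _))// lerD2l.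
apply: (le_trans (HC _ _)); rewrite ler_wpM2l ?(ltW C0)// LedistC.
by apply: ge0_ler_powR; rewrite ?nnegrE ?sqrtr_ge0 ?(ltW a0) ?(ltW oy)// (le_trans ler01).
Qed.

Section lebesgue_n.
Variables (mu : {measure set (n.-tuple R) -> \bar R}) (Hmu : Lis_lebesgue_measure_n mu).

(* A copy of [mu] that carries the sigma-finite structure required by Fubini. *)
Definition lebesgue_n of Lis_lebesgue_measure_n mu : set (n.-tuple R) -> \bar R := mu.

HB.instance Definition _ := isMeasure.Build _ _ _ (lebesgue_n Hmu)
  (measure0 mu) (fun A => measure_ge0 mu A) (@measure_semi_sigma_additive _ _ _ mu).

Let sigma_finite_lebesgue_n : sigma_finite setT (lebesgue_n Hmu).
Proof.
pose o : n.-tuple R := [tuple 0 | i < n].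
exists (fun k => [set y | Ledist o y < k%:R]).
  apply/esym/seteqP; split => // y _; exists (Num.bound (Ledist o y)) => //=.
  by rewrite archi_boundP// sqrtr_ge0.
by move=> k; split; [exact: measurable_ball_Ledist|exact: measure_ball_lty].
Qed.

HB.instance Definition _ := @Measure_isSigmaFinite.Build _ _ _ (lebesgue_n Hmu)
  sigma_finite_lebesgue_n.

End lebesgue_n.

End holder.

Lemma integrable_bounded d (T : measurableType d) (R : realType)
    (m : {measure set T -> \bar R}) (D : set T) (k g : T -> R) (B : R) :
  measurable D -> m.-integrable D (EFin \o k) -> measurable_fun D g ->
  (forall y, `|g y| <= B) -> m.-integrable D (EFin \o (fun y => k y * g y)).
Proof.
move=> mD ik mg gB; have iB := integrableZl mD B ik.
apply: (le_integrable mD _ _ iB).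
  apply/measurable_EFinP; apply: measurable_funM => //.
  by apply/measurable_EFinP; exact: measurable_int ik.
move=> y _ /=; rewrite lee_fin !normrM mulrC ler_wpM2r//.
by rewrite (le_trans (gB y))// ler_norm.
Qed.

(** * Integrals of jumps against a weight *)

Section jump_weight.
Context {R : realType}.
Local Notation leb := (@lebesgue_measure R).

(** [V] is the mass of the event t < phi and [W] the total mass, so for a probability density the
    value is (P(t < phi) - 1_{t<1}) / t. This evaluates the inner integral of
    [integral_log_mean]. *)
Lemma integral_jump_weight (phi w : R -> R) (V W t : R) : 0 < t ->
  measurable_fun setT phi ->
  leb.-integrable `]0, +oo[ (EFin \o w) ->
  (\int[leb]_(u in `]0%R, +oo[) (w u)%:E = W%:E)%E ->
  (\int[leb]_(u in `]0%R, +oo[) (if (t < phi u)%R then w u else 0)%:E = V%:E)%E ->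
  (\int[leb]_(u in `]0%R, +oo[) (jump (phi u) t / t * w u)%:E =
    ((V - (if t < 1 then 1 else 0) * W) / t)%:E)%E.
Proof.
move=> t0 mphi iw wW wV.
have mI : measurable (`]0, +oo[%classic : set (measurableTypeR R)) by exact: measurable_itv.
pose b : R := if t < 1 then 1 else 0.
pose k u := if t < phi u then w u else 0.
have ik : leb.-integrable `]0, +oo[ (EFin \o k).
  have := @integrable_bounded _ (measurableTypeR R) R leb `]0, +oo[ w
    (fun u => if t < phi u then 1 else 0) 1 mI iw.
  rewrite (_ : EFin \o (fun u => _ * _) = EFin \o k); last first.
    by apply/funext => u; rewrite /k /=; case: ifP => _; rewrite ?mulr1 ?mulr0.
  apply; first by apply: measurable_funTS; apply: measurable_fun_ifT => //; exact: measurable_fun_ltr.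
  by move=> u; case: ifP => _; rewrite ?normr1 ?normr0.
have ibw : leb.-integrable `]0, +oo[ (fun u => b%:E * (w u)%:E)%E.
  exact: (@integrableZl _ (measurableTypeR R) R leb _ mI b _ iw).
have Ebw : (\int[leb]_(u in `]0%R, +oo[) (b%:E * (w u)%:E) = (b * W)%:E)%E.
  by rewrite (@integralZl _ (measurableTypeR R) R leb _ mI _ iw) wW.
have iB := @integrableB _ (measurableTypeR R) R leb _ mI _ _ ik ibw.
have EB : (\int[leb]_(u in `]0%R, +oo[) ((k u)%:E - b%:E * (w u)%:E) = (V - b * W)%:E)%E.
  by rewrite (@integralB _ (measurableTypeR R) R leb _ mI _ _ ik ibw) Ebw wV.
transitivity (\int[leb]_(u in `]0%R, +oo[) (t^-1%:E * ((k u)%:E - b%:E * (w u)%:E)))%E.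
  apply: eq_integral => u _; rewrite -[RHS]/((t^-1 * (k u - b * w u))%:E); congr EFin.
  rewrite /jump /k /b /=; case: (t < phi u); case: (t < 1); rewrite ?mul0r; ring.
rewrite (@integralZl _ (measurableTypeR R) R leb _ mI _ iB) EB -EFinM; congr EFin.
by rewrite mulrC.
Qed.

End jump_weight.

(** * The volume constant and the heat kernel *)

Section heat_kernel.
Context (R : realType) (n : nat) (mu : {measure set (n.-tuple R) -> \bar R}).
Hypotheses (Hmu : Lis_lebesgue_measure_n mu) (n0 : (0 < n)%N).
Variable x : n.-tuple R.
Local Notation leb := (@lebesgue_measure R).
Local Notation q := (n%:R / 2 : R).
Local Notation kappa := (fine (mu [set y | Ledist x y < 1])).
Local Notation cn := (Lc_n R n).

Let q0 : 0 < q. Proof. by rewrite divr_gt0// ltr0n. Qed.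

Let mexpN : measurable_fun setT (fun v : R => expR (- v)).
Proof. by apply: (measurableT_comp (@measurable_expR R)). Qed.

(** Both sides are the Gaussian integral over R^n, computed radially on the left and coordinatewise
    on the right; equivalently, the unit ball has volume pi^q / Gamma(q + 1). *)
Let kappa_LGamma : kappa * q * LGamma q = pi `^ q.
Proof.
have kq0 : 0 <= kappa * q by rewrite mulr_ge0 ?fine_ge0// ltW.
have mg : measurable_fun setT (fun u : R => (expR (- u))%:E) by exact/measurable_EFinP.
have E := radial_kappa Hmu n0 x ltr01 mg (fun u => expR_ge0 (- u)).
have E1 : (\int[mu]_y (expR (- (Ledist x y ^+ 2 / 1)))%:E = (pi `^ q)%:E)%E.
  by under eq_integral do rewrite divr1; exact: integral_gauss_n.
have E2 : (\int[leb]_(u in `]0%R, +oo[) ((expR (- u))%:E * (kappa * q * 1 `^ q * u `^ (q - 1))%:E)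
    = (kappa * q * LGamma q)%:E)%E.
  transitivity (\int[leb]_(u in `]0%R, +oo[) ((kappa * q)%:E * (gammaf q u)%:E))%E.
    apply: eq_integral => u _; rewrite -!EFinM; congr EFin.
    by rewrite powR1 /gammaf; ring.
  rewrite (ge0_integralZl_leb kq0 (gammaf_ge0 q) (@measurable_gammaf R q setT) (measurable_itv _)).
  by rewrite (integral_gammaf q0) -EFinM.
by apply: EFin_inj; rewrite -E2 -E1 -E.
Qed.

Let powpi_gt0 : 0 < (pi : R) `^ q. Proof. by rewrite powR_gt0// pi_gt0. Qed.

(** Read off from [kappa_LGamma]: its right-hand side is positive and [kappa * q] is nonnegative. *)
Lemma LGamma_half_gt0 : 0 < LGamma q.
Proof.
have kq0 : 0 <= kappa * q by rewrite mulr_ge0 ?fine_ge0// ltW.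
rewrite ltNge; apply/negP => G0; have := powpi_gt0.
by rewrite -kappa_LGamma ltNge mulr_ge0_le0.
Qed.

Lemma Lc_n_gt0 : 0 < cn.
Proof. by rewrite mulr_gt0 ?LGamma_half_gt0// powR_gt0// pi_gt0. Qed.

(** Since |S^{n-1}| = n kappa, this is the formula c_n = 2 / |S^{n-1}|. *)
Let kappaE : kappa * q = cn^-1.
Proof.
rewrite /Lc_n powRN invfM invrK -kappa_LGamma mulfK// gt_eqF// LGamma_half_gt0//.
Qed.

Lemma integral_radial (c : R) (g : R -> \bar R) : 0 < c ->
  measurable_fun setT g -> (forall u, 0 <= g u)%E ->
  (\int[mu]_y g (Ledist x y ^+ 2 / c)%R =
   \int[leb]_(u in `]0%R, +oo[) (g u * (cn^-1 * c `^ q * u `^ (q - 1))%:E))%E.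
Proof. by move=> c0 mg g0; rewrite (radial_kappa Hmu n0 x c0 mg g0) kappaE. Qed.

Definition heatk (t : R) (y : n.-tuple R) : R :=
  (4 * pi * t) `^ (- q) * expR (- (Ledist x y ^+ 2 / (4 * t))).

Lemma heatk_ge0 t y : 0 <= heatk t y.
Proof. by rewrite mulr_ge0 ?powR_ge0 ?expR_ge0. Qed.

Lemma measurable_heatk t : measurable_fun setT (heatk t).
Proof.
apply: measurable_funM => //; apply: (measurableT_comp mexpN).
exact: measurable_Ledist_sqr.
Qed.

(** Under the heat kernel, r^2 / (4 t) has the normalised Gamma(q) law for every t: the powers of 4
    t in the kernel and in the radial weight cancel. *)
Lemma integral_heatk_radial (t : R) (h : R -> R) : 0 < t ->
  measurable_fun setT h -> (forall u, 0 <= h u) ->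
  (\int[mu]_y (h (Ledist x y ^+ 2 / (4 * t)) * heatk t y)%:E =
   (LGamma q)^-1%:E * \int[leb]_(u in `]0%R, +oo[) (h u * gammaf q u)%:E)%E.
Proof.
move=> t0 mh h0; have t40 : 0 < 4 * t by rewrite mulr_gt0.
have G0 := LGamma_half_gt0.
have GV0 : 0 <= (LGamma q)^-1 by rewrite invr_ge0 ltW.
pose g (u : R) := (h u * ((4 * pi * t) `^ (- q) * expR (- u)))%:E.
have mg : measurable_fun setT g.
  by apply/measurable_EFinP; apply: measurable_funM => //; exact: measurable_funM.
have g0 u : (0 <= g u)%E by rewrite lee_fin mulr_ge0// mulr_ge0 ?powR_ge0 ?expR_ge0.
have E := integral_radial t40 mg g0.
have mhg : measurable_fun setT (fun u => h u * gammaf q u).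
  by apply: measurable_funM => //; exact: measurable_gammaf.
have hg0 u : 0 <= h u * gammaf q u by rewrite mulr_ge0// gammaf_ge0.
rewrite -(ge0_integralZl_leb GV0 hg0 mhg (measurable_itv _)) E.
apply: eq_integral => u _; rewrite -!EFinM; congr EFin.
have -> : 4 * pi * t = pi * (4 * t) by ring.
rewrite (powRM _ (pi_ge0 R) (ltW t40)) /Lc_n /gammaf !powRN !invfM invrK.
have h1 := powpi_gt0; have h2 : 0 < (4 * t) `^ q by exact: powR_gt0.
have h3 : pi `^ q != 0 :> R by rewrite gt_eqF.
have h4 : (4 * t) `^ q != 0 by rewrite gt_eqF.
set P := pi `^ q in h3 *; set Q := (4 * t) `^ q in h4 *.
field.
by rewrite h3 h4 (gt_eqF G0).
Qed.

Lemma integral_heatk t : 0 < t -> (\int[mu]_y (heatk t y)%:E = 1)%E.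
Proof.
move=> t0; have := @integral_heatk_radial t (cst 1) t0 (measurable_cst _) (fun=> ler01).
under eq_integral do rewrite mul1r.
under [in X in _ = X -> _]eq_integral do rewrite mul1r.
move=> ->; rewrite (integral_gammaf q0) -EFinM mulVf// gt_eqF//.
exact: LGamma_half_gt0.
Qed.

Lemma integrable_heatk t : 0 < t -> mu.-integrable setT (EFin \o heatk t).
Proof.
move=> t0; apply: ge0_integrable; first exact: measurable_heatk.
  by move=> y _; exact: heatk_ge0.
by rewrite integral_heatk// ltry.
Qed.

Definition heat_ball (t : R) : R :=
  Rintegral mu setT (fun y => heatk t y * (if Ledist x y < 1 then 1 else 0)).

Lemma measurable_ball_ind : measurable_fun setT (fun y => if Ledist x y < 1 then 1 else 0 : R).
Proof.
apply: measurable_fun_ifT => //; apply: measurable_fun_ltr => //.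
exact: measurable_Ledist.
Qed.

Lemma integrable_heatk_ball t : 0 < t ->
  mu.-integrable setT (EFin \o (fun y => heatk t y * (if Ledist x y < 1 then 1 else 0))).
Proof.
move=> t0; apply: (integrable_bounded (B := 1)) => //; first exact: integrable_heatk.
  exact: measurable_ball_ind.
by move=> y; case: ifP => _; rewrite ?normr1 ?normr0.
Qed.

(** With U = r^2 / (4 t), the unit ball is the event U < 1 / (4 t), that is t < 1 / (4 U). The
    factor Gamma(q) appears because [gammaf q] is not normalised. *)
Lemma integral_jump_ball t : 0 < t ->
  (\int[leb]_(u in `]0%R, +oo[) (jump ((4 * u)^-1) t / t * gammaf q u)%:E =
   (LGamma q * (heat_ball t - (if t < 1 then 1 else 0)) / t)%:E)%E.
Proof.
move=> t0; have t40 : 0 < 4 * t by rewrite mulr_gt0.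
have G0 := LGamma_half_gt0.
rewrite (@integral_jump_weight R (fun u => (4 * u)^-1) (gammaf q)
  (LGamma q * heat_ball t) (LGamma q) t t0 _ (integrable_gammaf q0) (integral_gammaf q0)).
- by rewrite mulrBr [(if _ then _ else _) * LGamma q]mulrC.
- by apply: (measurableT_comp (@measurable_invr R)); exact: measurable_funM.
pose h (u : R) : R := if u < (4 * t)^-1 then 1 else 0.
have mh : measurable_fun setT h by apply: measurable_fun_ifT => //; exact: measurable_fun_ltr.
have h0 u : 0 <= h u by rewrite /h; case: ifP.
have E := integral_heatk_radial t0 mh h0.
have E1 : (\int[mu]_y (h (Ledist x y ^+ 2 / (4 * t)) * heatk t y)%:E = (heat_ball t)%:E)%E.
  rewrite /heat_ball /Rintegral fineK; last by apply: integrable_fin_num => //; exact: integrable_heatk_ball.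
  apply: eq_integral => y _; rewrite /h mulrC; congr (_ * _)%:E.
  rewrite -[X in _ < X]mul1r (ltr_pM2r (_ : 0 < (4 * t)^-1)) ?invr_gt0//.
  by rewrite expr_lt1// sqrtr_ge0.
have E2 : (\int[leb]_(u in `]0%R, +oo[) (h u * gammaf q u)%:E =
    \int[leb]_(u in `]0%R, +oo[) (if (t < (4 * u)^-1)%R then gammaf q u else 0)%:E)%E.
  apply: eq_integral => u; rewrite inE/= in_itv/= andbT => u0.
  have -> : (t < (4 * u)^-1) = (u < (4 * t)^-1).
    rewrite -[(4 * u)^-1]mul1r -[(4 * t)^-1]mul1r.
    by rewrite !ltr_pdivlMr ?mulr_gt0// [t * (4 * u)]mulrCA [u * (4 * t)]mulrCA [t * u]mulrC.
  by rewrite /h; case: ifP => _; rewrite ?mul1r ?mul0r.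
rewrite -E2 EFinM -E1 E muleA -EFinM divff ?mul1e//.
by rewrite gt_eqF.
Qed.

(** This is [integral_powR_expRN_inv] with c = r^2 / 4; the powers of 4 cancel and (r^2)^(-q) =
    r^(-n). The integral diverges at r = 0. *)
Lemma integral_heatk_dt (y : n.-tuple R) : 0 < Ledist x y ->
  (\int[leb]_(t in `]0%R, +oo[) (heatk t y / t)%:E = (cn / Ledist x y ^+ n)%:E)%E.
Proof.
move=> r0; set r := Ledist x y in r0 *.
have c0 : 0 < r ^+ 2 / 4 by rewrite divr_gt0// exprn_gt0.
have p40 : 0 <= 4 * pi :> R by rewrite mulr_ge0 ?pi_ge0.
pose k (t : R) := t `^ (- q - 1) * expR (- ((r ^+ 2 / 4) / t)).
have k0 t : 0 <= k t by rewrite mulr_ge0 ?powR_ge0 ?expR_ge0.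
have mk : measurable_fun setT k.
  apply: measurable_funM; first exact: measurable_powR.
  by apply: (measurableT_comp mexpN); apply: measurable_funM => //; exact: measurable_invr.
transitivity (\int[leb]_(t in `]0%R, +oo[) (((4 * pi) `^ (- q))%:E * (k t)%:E))%E.
  apply: eq_integral => t; rewrite inE/= in_itv/= andbT => t0.
  rewrite -EFinM; congr EFin; rewrite /heatk -/r /k (powRM _ p40 (ltW t0)).
  have -> : t `^ (- q - 1) = t `^ (- q) / t.
    by rewrite powRD ?(gt_eqF t0) ?implybT// powR_inv1// ltW.
  have -> : r ^+ 2 / (4 * t) = r ^+ 2 / 4 / t by rewrite invfM mulrA.
  ring.
rewrite (ge0_integralZl_leb (powR_ge0 _ _) k0 mk (measurable_itv _)).
rewrite (integral_powR_expRN_inv q0 c0) -EFinM; congr EFin.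
have -> : (r ^+ 2 / 4) `^ (- q) = 4 `^ q / r ^+ n.
  rewrite powRN (powRM _ (sqr_ge0 r)) ?invr_ge0//.
  rewrite -[4^-1]powR_inv1// -powRrM mulN1r powRN invfM invrK mulrC; congr (_ / _).
  rewrite -[r ^+ 2]powR_mulrn ?(ltW r0)// -powRrM (_ : 2%:R * q = n%:R).
    by rewrite powR_mulrn// ltW.
  by field.
rewrite /Lc_n (powRM _ _ (pi_ge0 R))// !powRN.
have h3 : pi `^ q != 0 :> R by rewrite gt_eqF.
have h4 : 4 `^ q != 0 :> R by rewrite gt_eqF// powR_gt0.
have h5 : r ^+ n != 0 by rewrite gt_eqF// exprn_gt0.
set P := pi `^ q in h3 *; set Q := 4 `^ q in h4 *; set S := r ^+ n in h5 *.
field.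
by rewrite h3 h4 h5.
Qed.

End heat_kernel.

(** * Logarithmic means of the exponential and Gamma laws *)

Section log_moments.
Context {R : realType}.
Local Notation leb := (@lebesgue_measure R).

Lemma gammaf1 (u : R) : gammaf 1 u = expR (- u).
Proof. by rewrite /gammaf subrr powRr0 mul1r. Qed.

Lemma LGamma1 : LGamma (1 : R) = 1.
Proof.
apply: EFin_inj; rewrite -(integral_gammaf ltr01).
transitivity (\int[leb]_(u in `]0%R, +oo[) (expR (- u))%:E)%E.
  by apply: eq_integral => u _; rewrite gammaf1.
by rewrite integral_expRN_oy oppr0 expR0.
Qed.

Lemma integral_jump_exp (t : R) : 0 < t ->
  (\int[leb]_(u in `]0%R, +oo[) (jump u t / t * gammaf 1 u)%:E =
   ((expR (- t) - (if t < 1 then 1 else 0)) / t)%:E)%E.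
Proof.
move=> t0; rewrite (@integral_jump_weight R id (gammaf 1) (expR (- t)) (LGamma 1) t t0 _
  (integrable_gammaf ltr01) (integral_gammaf ltr01)).
- by rewrite LGamma1 mulr1.
- exact: measurable_id.
rewrite -integral_expRN_oy integral_mkcond [RHS]integral_mkcond.
apply: eq_integral => u _; rewrite !patchE !mem_setE !in_itv/= !andbT gammaf1.
by case: (ltP t u) => tu; [rewrite (lt_trans t0 tu)|case: ifP].
Qed.

Lemma log_mean_exp :
  leb.-integrable `]0, +oo[
    (fun t => \int[leb]_(u in `]0%R, +oo[) (jump u t / t * gammaf 1 u)%:E)%E /\
  (\int[leb]_(t in `]0%R, +oo[) \int[leb]_(u in `]0%R, +oo[) (jump u t / t * gammaf 1 u)%:E =
   (- Leuler_gamma R)%:E)%E.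
Proof.
have [i e] := @integral_log_mean R id (gammaf 1) (@measurable_id _ _ _)
  (@measurable_gammaf R 1 setT) (fun u u0 => u0) (gammaf_ge0 1) (integrable_ln_gammaf ltr01).
split => //; rewrite e /Leuler_gamma opprK; exact: derive1_LGamma.
Qed.

(** Here ln (1 / (4 u)) = - 2 ln 2 - ln u is integrated against the unnormalised density, whence the
    factor Gamma(q) and the derivative of Gamma in place of psi. *)
Lemma log_mean_gamma (q : R) : 0 < q ->
  leb.-integrable `]0, +oo[
    (fun t => \int[leb]_(u in `]0%R, +oo[) (jump ((4 * u)^-1) t / t * gammaf q u)%:E)%E /\
  (\int[leb]_(t in `]0%R, +oo[) \int[leb]_(u in `]0%R, +oo[)
      (jump ((4 * u)^-1) t / t * gammaf q u)%:E =
   (- (2 * ln 2) * LGamma q - derive1 (@LGamma R) q)%:E)%E.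
Proof.
move=> q0.
have mI : measurable (`]0, +oo[%classic : set (measurableTypeR R)) by exact: measurable_itv.
have ig := integrable_gammaf q0; have il := integrable_ln_gammaf q0.
have icg := @integrableZl _ (measurableTypeR R) R leb _ mI (- (2 * ln 2)) _ ig.
have iB := @integrableB _ (measurableTypeR R) R leb _ mI _ _ icg il.
have lnE (u : R) : 0 < u -> ln ((4 * u)^-1) = - (2 * ln 2) - ln u.
  move=> u0; rewrite lnV ?posrE ?mulr_gt0// lnM ?posrE// (_ : 4 = 2 ^+ 2 :> R); last by rewrite -natrX.
  by rewrite lnXn// mulr2n; ring.
have E u : 0 < u -> (ln ((4 * u)^-1) * gammaf q u)%:E =
    ((- (2 * ln 2))%:E * (gammaf q u)%:E - (ln u * gammaf q u)%:E)%E.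
  move=> u0; rewrite -[RHS]/((- (2 * ln 2) * gammaf q u - ln u * gammaf q u)%:E).
  by rewrite lnE// mulrBl.
have iphi : leb.-integrable `]0, +oo[ (EFin \o (fun u => ln ((4 * u)^-1) * gammaf q u)).
  apply: (eq_integrable _ _ _ _ iB) => // u; rewrite inE/= in_itv/= andbT => u0.
  by rewrite E.
have mphi : measurable_fun setT (fun u : R => (4 * u)^-1).
  by apply: (measurableT_comp (@measurable_invr R)); exact: measurable_funM.
have phi0 (u : R) : 0 < u -> 0 < (4 * u)^-1 by move=> u0; rewrite invr_gt0 mulr_gt0.
have [i e] := @integral_log_mean R _ (gammaf q) mphi (@measurable_gammaf R q setT)
  phi0 (gammaf_ge0 q) iphi.
split => //; rewrite e.
transitivity (\int[leb]_(u in `]0%R, +oo[) ((- (2 * ln 2))%:E * (gammaf q u)%:E - (ln u * gammaf q u)%:E))%E.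
  by apply: eq_integral => u; rewrite inE/= in_itv/= andbT => u0; exact: E.
rewrite (@integralB _ (measurableTypeR R) R leb _ mI _ _ icg il).
rewrite (@integralZl _ (measurableTypeR R) R leb _ mI _ ig).
by rewrite (integral_gammaf q0) (derive1_LGamma q0).
Qed.

End log_moments.

(** * The singular integrals, and Fubini in time and space *)

Section kernel_integrals.
Context (R : realType) (n : nat) (mu : {measure set (n.-tuple R) -> \bar R}).
Hypotheses (Hmu : Lis_lebesgue_measure_n mu) (n0 : (0 < n)%N).
Variables (x : n.-tuple R) (f : n.-tuple R -> R) (a : R).
Hypotheses (a0 : 0 < a) (cf : Lhas_compact_support f) (hf : Lhoelder a f).
Local Notation leb := (@lebesgue_measure R).
Local Notation q := (n%:R / 2 : R).
Local Notation cn := (Lc_n R n).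

Definition cut_diff (y : n.-tuple R) : R := f x * (if Ledist x y < 1 then 1 else 0) - f y.

Let q0 : 0 < q. Proof. by rewrite divr_gt0// ltr0n. Qed.

Let mf : measurable_fun setT f. Proof. exact: measurable_Lhoelder hf. Qed.

Lemma measurable_cut_diff : measurable_fun setT cut_diff.
Proof. by apply: measurable_funB => //; apply: measurable_funM => //; exact: measurable_ball_ind. Qed.

(** Makes the time integral equal to [cn * (cut_diff y / Ledist x y ^+ n)] also at r = 0, where both
    sides are 0, so that Fubini can be computed at every point. *)
Lemma cut_diff0 y : Ledist x y = 0 -> cut_diff y = 0.
Proof.
move=> r0; have [C C0 HC] := Lhoelder_ge0 hf.
rewrite /cut_diff r0 ltr01 mulr1; apply/eqP; rewrite -normr_le0.
by have := HC x y; rewrite r0 powR0 ?gt_eqF// mulr0.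
Qed.

(** In the variable u = r^2, the function r^(a - n) is u^(a/2 - n/2); against the radial weight
    u^(n/2 - 1) it leaves u^(a/2 - 1), integrable at 0 because a > 0. *)
Lemma integrable_riesz (C : R) : 0 <= C -> mu.-integrable setT
  (EFin \o (fun y => if Ledist x y < 1 then C * Ledist x y `^ a / Ledist x y ^+ n else 0)).
Proof.
move=> C0.
pose h (u : R) := if u < 1 then C * Num.sqrt u `^ a / Num.sqrt u ^+ n else 0.
have ms : measurable_fun setT (fun u : R => Num.sqrt u).
  by apply: continuous_measurable_fun; exact: sqrt_continuous.
have mh : measurable_fun setT h.
  apply: measurable_fun_ifT => //; first exact: measurable_fun_ltr.
  apply: measurable_funM; last first.
    by apply: (measurableT_comp (@measurable_invr R)); exact: measurable_funX.
  by apply: measurable_funM => //; apply: (measurableT_comp (measurable_powR _)).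
have h0 u : 0 <= h u.
  rewrite /h; case: ifP => // _; apply: divr_ge0.
    by apply: mulr_ge0 => //; exact: powR_ge0.
  by apply: exprn_ge0; exact: sqrtr_ge0.
have hE y : (if Ledist x y < 1 then C * Ledist x y `^ a / Ledist x y ^+ n else 0) = h (Ledist x y ^+ 2 / 1).
  by rewrite /h divr1 expr_lt1 ?Ledist_ge0// sqrtr_sqr ger0_norm// Ledist_ge0.
have mE : measurable_fun setT (fun y => h (Ledist x y ^+ 2 / 1)).
  by apply: (measurableT_comp mh); exact: measurable_Ledist_sqr.
rewrite (_ : (fun y => _) = (fun y => h (Ledist x y ^+ 2 / 1))); last by apply/funext => y; exact: hE.
apply: ge0_integrable => //.
have mhE : measurable_fun setT (EFin \o h) by exact/measurable_EFinP.
have := integral_radial Hmu n0 x ltr01 mhE (fun u => h0 u) => /= ->.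
have k0 : 0 <= C * cn^-1 by apply: mulr_ge0 => //; rewrite invr_ge0; apply: ltW; exact: (Lc_n_gt0 Hmu n0 x).
have a20 : 0 < a / 2 by exact: divr_gt0.
rewrite [X in (X < _)%E](_ : _ = (C * cn^-1)%:E * \int[leb]_(u in `]0%R, 1%R[) (u `^ (a / 2 - 1))%:E)%E.
  by rewrite (integral_powR_0o a20 ltr01) -EFinM ltry.
rewrite -(ge0_integralZl_leb k0 (fun u => powR_ge0 u (a / 2 - 1)) (measurable_powR _) (measurable_itv `]0, 1[)).
rewrite integral_mkcond [RHS]integral_mkcond; apply: eq_integral => u _.
rewrite !patchE !mem_setE !in_itv/= andbT; case: (ltP 0 u) => //= u0.
rewrite /h; case: ifP => u1; last by rewrite mul0e.
rewrite -!EFinM; congr EFin; rewrite powR1 -(powR12_sqrt (ltW u0)).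
rewrite -powR_mulrn ?powR_ge0// -!powRrM.
have -> : u `^ (a / 2 - 1) = u `^ (2^-1 * a) / u `^ (2^-1 * n%:R) * u `^ (q - 1).
  have un0 : u != 0 by rewrite gt_eqF.
  by rewrite -powRN -!powRD ?un0 ?implybT//; congr powR; ring.
rewrite mulr1; set X := u `^ (2^-1 * a); set Y := u `^ (2^-1 * n%:R); set Z := u `^ (q - 1).
ring.
Qed.

(** Inside the unit ball the Hoelder bound gives the kernel of [integrable_riesz]. Outside, r^(-n)
    <= 1 and [f] is bounded by [B] and vanishes beyond [rho]. *)
Lemma integrable_cut_diff : mu.-integrable setT (EFin \o (fun y => cut_diff y / Ledist x y ^+ n)).
Proof.
have [C C0 HC] := Lhoelder_ge0 hf.
have [B B0 fB] := Lhoelder_bounded a0 cf hf.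
have [rho rho1 Hrho] := compact_support_far x cf.
have i1 := integrable_riesz (ltW C0).
have i2 : mu.-integrable setT (EFin \o (fun y => if Ledist x y < rho then B else 0)).
  rewrite (_ : EFin \o _ = (EFin \o cst B) \_ [set y | Ledist x y < rho]); last first.
    apply/funext => y; rewrite patchE /=; have [yrho|yrho] := ltP (Ledist x y) rho.
      by rewrite mem_set.
    by rewrite memNset//=; apply/negP; rewrite -leNgt.
  have mb : measurable [set y | Ledist x y < rho] by exact: measurable_ball_Ledist.
  apply: integrable_patch => //; apply: ge0_integrable => //.
  all: try by move=> y _; exact: B0.
  apply: (@le_lt_trans _ _ (B%:E * mu [set y | (Ledist x y < rho)%R])%E).
    by rewrite -(integral_cst mu mb B%:E); exact: lexx.
  by rewrite lte_mul_pinfty ?lee_fin// measure_ball_lty.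
apply: (le_integrable measurableT _ _ (integrableD measurableT i1 i2)).
  apply/measurable_EFinP; apply: measurable_funM; first exact: measurable_cut_diff.
  apply: (measurableT_comp (@measurable_invr R)).
  by apply: measurable_funX; exact: measurable_Ledist.
move=> y _.
suff : `|cut_diff y / Ledist x y ^+ n| <=
    `|(if Ledist x y < 1 then C * Ledist x y `^ a / Ledist x y ^+ n else 0) +
      (if Ledist x y < rho then B else 0)| by rewrite -lee_fin; exact.
set r := Ledist x y; have r0 : 0 <= r by exact: Ledist_ge0.
have rn0 : 0 <= (r ^+ n)^-1 by rewrite invr_ge0 exprn_ge0.
apply: le_trans (ler_norm _).
rewrite normrM (ger0_norm rn0) /cut_diff -/r.
have [r1|r1] := ltP r 1.
  apply: (@le_trans _ _ (C * r `^ a / r ^+ n)).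
    by rewrite mulr1 ler_wpM2r// HC.
  by rewrite lerDl; case: ifP.
rewrite mulr0 sub0r normrN add0r; have [rr|rr] := ltP r rho; last first.
  by rewrite Hrho// normr0 mul0r.
apply: le_trans (fB y); rewrite ler_piMr// invf_le1 ?exprn_ege1//.
by rewrite exprn_gt0// (lt_le_trans ltr01).
Qed.

(** As the heat kernel is nonnegative, the absolute integral in time is c_n |[cut_diff]| / r^n, so
    the condition of Fubini is [integrable_cut_diff]. *)
Lemma heat_fubini :
  leb.-integrable `]0, +oo[ (fun t => \int[mu]_y (heatk x t y * cut_diff y / t)%:E)%E /\
  (\int[leb]_(t in `]0%R, +oo[) \int[mu]_y (heatk x t y * cut_diff y / t)%:E =
   (cn * Rintegral mu setT (fun y => cut_diff y / Ledist x y ^+ n))%:E)%E.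
Proof.
pose F (z : R * n.-tuple R) : \bar R := (heatk x z.1 z.2 * cut_diff z.2 / z.1)%:E.
have mI : measurable (`]0, +oo[%classic : set (measurableTypeR R)) by exact: measurable_itv.
have mr : measurable_fun setT (fun z : R * n.-tuple R => Ledist x z.2).
  by apply: (measurableT_comp (measurable_Ledist x)).
have mF : measurable_fun setT F.
  apply/measurable_EFinP; apply: measurable_funM; last first.
    exact: (measurableT_comp (@measurable_invr R)).
  apply: measurable_funM; last by apply: (measurableT_comp measurable_cut_diff).
  apply: measurable_funM.
    by apply: (measurableT_comp (measurable_powR _)); exact: measurable_funM.
  apply: (measurableT_comp (@measurable_expR R)); apply: measurableT_comp => //.
  apply: measurable_funM; first exact: measurable_funX.
  by apply: (measurableT_comp (@measurable_invr R)); exact: measurable_funM.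
have mk y : measurable_fun setT (fun t => heatk x t y / t).
  apply: measurable_funM; last exact: measurable_invr.
  apply: measurable_funM.
    by apply: (measurableT_comp (measurable_powR _)); exact: measurable_funM.
  apply: (measurableT_comp (@measurable_expR R)); apply: measurableT_comp => //.
  apply: measurable_funM => //.
  by apply: (measurableT_comp (@measurable_invr R)); exact: measurable_funM.
have ik y : 0 < Ledist x y -> leb.-integrable `]0, +oo[ (EFin \o (fun t => heatk x t y / t)).
  move=> r0; apply: (@ge0_integrable _ (measurableTypeR R)).
  - by apply: measurable_funTS; exact: mk.
  - by move=> t; rewrite /= in_itv/= andbT => t0; rewrite mulr_ge0 ?heatk_ge0// invr_ge0 ltW.
  - by rewrite (integral_heatk_dt n0 r0) ltry.
have I1 y : (\int[leb]_(t in `]0%R, +oo[) F (t, y) = (cn * (cut_diff y / Ledist x y ^+ n))%:E)%E.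
  have [r0|r0] := eqVneq (Ledist x y) 0.
    rewrite (cut_diff0 r0) mul0r mulr0; apply: integral0_eq => t _.
    by rewrite /F/= (cut_diff0 r0) mulr0 mul0r.
  have {}r0 : 0 < Ledist x y by rewrite lt_neqAle eq_sym r0 Ledist_ge0.
  transitivity (\int[leb]_(t in `]0%R, +oo[) ((cut_diff y)%:E * (heatk x t y / t)%:E))%E.
    by apply: eq_integral => t _; rewrite /F/= -EFinM; congr EFin; ring.
  rewrite (@integralZl _ (measurableTypeR R) R leb _ mI _ (ik y r0)).
  by rewrite (integral_heatk_dt n0 r0) -EFinM; congr EFin; ring.
have I2 y : (\int[leb]_(t in `]0%R, +oo[) `|F (t, y)| = (cn * `|cut_diff y / Ledist x y ^+ n|)%:E)%E.
  have [r0|r0] := eqVneq (Ledist x y) 0.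
    rewrite (cut_diff0 r0) mul0r normr0 mulr0; apply: integral0_eq => t _.
    by rewrite /F/= (cut_diff0 r0) mulr0 mul0r normr0.
  have {}r0 : 0 < Ledist x y by rewrite lt_neqAle eq_sym r0 Ledist_ge0.
  transitivity (\int[leb]_(t in `]0%R, +oo[) (`|cut_diff y|%:E * (heatk x t y / t)%:E))%E.
    apply: eq_integral => t; rewrite inE/= in_itv/= andbT => t0.
    rewrite /F/= -EFinM; congr EFin; rewrite normrM normfV (gtr0_norm t0) normrM (ger0_norm (heatk_ge0 _ _ _)).
    ring.
  rewrite (@integralZl _ (measurableTypeR R) R leb _ mI _ (ik y r0)).
  rewrite (integral_heatk_dt n0 r0) -EFinM; congr EFin.
  rewrite normrM normfV (ger0_norm (exprn_ge0 _ (Ledist_ge0 _ _))); ring.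
have cn0 : 0 <= cn by apply: ltW; exact: (Lc_n_gt0 Hmu n0 x).
have iA := integrable_cut_diff.
have foo : (\int[lebesgue_n Hmu]_(y in setT) \int[leb]_(t in `]0%R, +oo[) `|F (t, y)| < +oo)%E.
  rewrite (eq_integral (fun y => cn%:E * `|(cut_diff y / Ledist x y ^+ n)%:E|)%E); last first.
    by move=> y _; rewrite I2 EFinM.
  rewrite ge0_integralZl_EFin//; last first.
    by apply: measurableT_comp => //; exact: measurable_int iA.
  by rewrite lte_mul_pinfty ?lee_fin//; have /integrableP[] := iA.
have [i e] := @fubini_in _ _ (measurableTypeR R) _ R leb (lebesgue_n Hmu)
  `]0, +oo[ setT F mI measurableT mF foo.
split; first exact: i.
have -> : (\int[leb]_(t in `]0%R, +oo[) \int[mu]_y (heatk x t y * cut_diff y / t)%:E =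
   \int[mu]_y \int[leb]_(t in `]0%R, +oo[) F (t, y))%E by exact: e.
transitivity (\int[mu]_y (cn%:E * (cut_diff y / Ledist x y ^+ n)%:E))%E.
  by apply: eq_integral => y _; rewrite I1.
rewrite (integralZl measurableT iA) [RHS]EFinM; congr (_ * _)%E.
by rewrite /Rintegral fineK//; exact: integrable_fin_num.
Qed.

(** For fixed t the integral may be split, because the kernel has mass 1 and is multiplied by the
    bounded functions [f] and the indicator of the ball. *)
Lemma integral_heat_cut_diff t : 0 < t ->
  (\int[mu]_y (heatk x t y * cut_diff y / t)%:E =
   ((f x * heat_ball mu x t - Lheat mu t f x) / t)%:E)%E.
Proof.
move=> t0.
have [B B0 fB] := Lhoelder_bounded a0 cf hf.
have ihb := integrable_heatk_ball Hmu n0 x t0.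
have ihf := integrable_bounded measurableT (integrable_heatk Hmu n0 x t0) mf fB.
have p0 : 0 < (4 * pi * t) `^ (- q) by rewrite powR_gt0// !mulr_gt0// pi_gt0.
have Ef : Lheat mu t f x = Rintegral mu setT (fun y => heatk x t y * f y).
  rewrite /Lheat -RintegralZl//.
    by apply: eq_Rintegral => y _; rewrite mulrA.
  have := integrableZl measurableT ((4 * pi * t) `^ (- q))^-1 ihf.
  apply: eq_integrable => // y _ /=; rewrite -EFinM; congr EFin.
  rewrite /heatk; set p := (4 * pi * t) `^ (- q) in p0 *.
  by rewrite -[p * _ * _]mulrA mulKf// gt_eqF.
have ih := integrableZl measurableT (f x) ihb.
have iB := integrableB measurableT ih ihf.
transitivity (\int[mu]_y (t^-1%:E * ((f x)%:E * (heatk x t y * (if (Ledist x y < 1)%R then 1 else 0))%:E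
    - (heatk x t y * f y)%:E)))%E.
  apply: eq_integral => y _.
  rewrite -[RHS]/((t^-1 * (f x * (heatk x t y * (if Ledist x y < 1 then 1 else 0)) - heatk x t y * f y))%:E).
  congr EFin; rewrite /cut_diff; ring.
rewrite (integralZl measurableT iB) (integralB measurableT ih ihf) (integralZl measurableT ihb).
rewrite Ef /heat_ball [X in _ = X%:E]mulrC [RHS]EFinM; congr (_ * _)%E.
rewrite [RHS]EFinB [X in _ = (X - _)%E]EFinM /Rintegral.
by congr (_ * _ - _)%E; rewrite fineK//; exact: integrable_fin_num.
Qed.

End kernel_integrals.

(** * Separation of the near and far singular integrals *)

Section cut_diff_split.
Context (R : realType) (n : nat) (mu : {measure set (n.-tuple R) -> \bar R}).
Variables (x : n.-tuple R) (f : n.-tuple R -> R).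
Local Notation I := [set y | Ledist x y < 1].
Local Notation O := [set y | 1 <= Ledist x y].

Lemma cut_diff_split :
  mu.-integrable setT (EFin \o (fun y => cut_diff x f y / Ledist x y ^+ n)) ->
  [/\ mu.-integrable I (fun y => ((f x - f y) / Ledist x y ^+ n)%:E),
      mu.-integrable O (fun y => (f y / Ledist x y ^+ n)%:E) &
      Rintegral mu setT (fun y => cut_diff x f y / Ledist x y ^+ n) =
      Rintegral mu I (fun y => (f x - f y) / Ledist x y ^+ n) -
      Rintegral mu O (fun y => f y / Ledist x y ^+ n)].
Proof.
move=> iA.
have mI : measurable I by exact: measurable_ball_Ledist.
have OE : O = ~` I by apply/seteqP; split => y /=; rewrite leNgt => /negP.
have mO : measurable O by rewrite OE; exact: measurableC.
have iI : mu.-integrable I (fun y => ((f x - f y) / Ledist x y ^+ n)%:E).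
  apply: (eq_integrable _ _ _ _ (integrableS measurableT mI (@subsetT _ I) iA)) => // y.
  by rewrite inE/= => y1; rewrite /cut_diff y1 mulr1.
have iO : mu.-integrable O (fun y => (f y / Ledist x y ^+ n)%:E).
  have iN := integrableZl mO (-1) (integrableS measurableT mO (@subsetT _ O) iA).
  apply: eq_integrable iN => // y; rewrite inE/= => y1.
  by rewrite /cut_diff ltNge y1 mulr0 sub0r -EFinM mulN1r mulNr opprK.
split => //.
have UE : I `|` O = setT by rewrite OE setUv.
have dIO : [disjoint I & O] by rewrite OE; apply/disj_setPCl.
rewrite -UE Rintegral_setU//; last by rewrite UE.
congr (_ + _).
  by apply: eq_Rintegral => y; rewrite inE/= => y1; rewrite /cut_diff y1 mulr1.
rewrite -mulN1r -RintegralZl//.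
apply: eq_Rintegral => y; rewrite inE/= => y1.
by rewrite /cut_diff ltNge y1 mulr0 sub0r mulN1r mulNr.
Qed.

End cut_diff_split.

(** * Assembly of the formula from three time integrals *)

Theorem theorem2 (R : realType) (n : nat) (beta : R)
  (mu : {measure set (n.-tuple R) -> \bar R})
  (f : n.-tuple R -> R) :
  (1 <= n)%N -> 0 < beta ->
  Lis_lebesgue_measure_n mu ->
  Lhas_compact_support f -> Lhoelder (Order.min beta 1) f ->
  forall x : n.-tuple R,
    (@lebesgue_measure R).-integrable `]0, +oo[%classic
      (fun t => ((expR (- t) * f x - Lheat mu t f x) / t)%:E) /\
    mu.-integrable [set y | Ledist x y < 1]
      (fun y => ((f x - f y) / Ledist x y ^+ n)%:E) /\
    mu.-integrable [set y | 1 <= Ledist x y]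
      (fun y => (f y / Ledist x y ^+ n)%:E) /\
    Rintegral (@lebesgue_measure R) `]0, +oo[%classic
      (fun t => (expR (- t) * f x - Lheat mu t f x) / t)
    = Lc_n R n * Rintegral mu [set y | Ledist x y < 1]
                  (fun y => (f x - f y) / Ledist x y ^+ n)
      - Lc_n R n * Rintegral mu [set y | 1 <= Ledist x y]
                  (fun y => f y / Ledist x y ^+ n)
      + Lrho_n R n * f x.
Proof.
move=> n0 beta0 Hmu cf hf x.
have a0 : 0 < Order.min beta 1 by rewrite lt_min beta0 ltr01.
have [iI iO splitE] := cut_diff_split (integrable_cut_diff Hmu n0 x a0 cf hf).
pose leb := @lebesgue_measure R; pose q : R := n%:R / 2.
have q0 : 0 < q by rewrite divr_gt0// ltr0n.
have G0 : 0 < LGamma q := LGamma_half_gt0 Hmu n0 x.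
have mT : measurable (`]0, +oo[%classic : set (measurableTypeR R)) by exact: measurable_itv.
have [i1 e1] := heat_fubini Hmu n0 x a0 cf hf.
have [i2 e2] := @log_mean_exp R.
have [i3 e3] := log_mean_gamma q0.
have i3' := @integrableZl _ (measurableTypeR R) R leb _ mT (LGamma q)^-1 _ i3.
have i23 := @integrableB _ (measurableTypeR R) R leb _ mT _ _ i2 i3'.
have i23' := @integrableZl _ (measurableTypeR R) R leb _ mT (f x) _ i23.
have iS := @integrableD _ (measurableTypeR R) R leb _ mT _ _ i1 i23'.
(* The heat content of the ball and the indicator 1_{t<1} cancel here. The grouping matters: neither
   e^(-t) / t nor the heat content divided by t is integrable near 0. *)
have SE t : 0 < t -> (\int[mu]_y (heatk x t y * cut_diff x f y / t)%:E +
    (f x)%:E * (\int[leb]_(u in `]0%R, +oo[) (jump u t / t * gammaf 1 u)%:E -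
      (LGamma q)^-1%:E * \int[leb]_(u in `]0%R, +oo[) (jump ((4 * u)^-1) t / t * gammaf q u)%:E) =
    ((expR (- t) * f x - Lheat mu t f x) / t)%:E)%E.
  move=> t0.
  rewrite (integral_heat_cut_diff Hmu n0 x a0 cf hf t0) (integral_jump_exp t0).
  rewrite (integral_jump_ball Hmu n0 x t0) -/q.
  rewrite -[LHS]/(((f x * heat_ball mu x t - Lheat mu t f x) / t + f x *
    ((expR (- t) - (if t < 1 then 1 else 0)) / t - (LGamma q)^-1 *
     (LGamma q * (heat_ball mu x t - (if t < 1 then 1 else 0)) / t)))%:E).
  congr EFin; set b : R := if t < 1 then 1 else 0.
  set Q := LGamma q in G0 *; set H := heat_ball mu x t; set L := Lheat mu t f x.
  have tn0 : t != 0 by rewrite gt_eqF.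
  have Qn0 : Q != 0 by rewrite gt_eqF.
  by field; rewrite tn0 Qn0.
split.
  apply: (@eq_integrable _ (measurableTypeR R) R leb _ mT _ _ _ iS) => t.
  by rewrite inE/= in_itv/= andbT => t0; exact: SE.
split => //; split => //.
transitivity (fine (\int[leb]_(t in `]0%R, +oo[) (\int[mu]_y (heatk x t y * cut_diff x f y / t)%:E +
    (f x)%:E * (\int[leb]_(u in `]0%R, +oo[) (jump u t / t * gammaf 1 u)%:E -
      (LGamma q)^-1%:E * \int[leb]_(u in `]0%R, +oo[) (jump ((4 * u)^-1) t / t * gammaf q u)%:E)))%E).
  congr fine; apply/esym; apply: eq_integral => t.
  by rewrite inE/= in_itv/= andbT => t0; exact: SE.
rewrite (@integralD _ (measurableTypeR R) R leb _ mT _ _ i1 i23').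
rewrite (@integralZl _ (measurableTypeR R) R leb _ mT _ i23).
rewrite (@integralB _ (measurableTypeR R) R leb _ mT _ _ i2 i3').
rewrite (@integralZl _ (measurableTypeR R) R leb _ mT _ i3).
rewrite e1 e2 e3 splitE.
rewrite /Lrho_n /Ldigamma -/q.
set A := Rintegral _ _ _; set B := Rintegral _ _ _; set c := Lc_n R n.
set D := derive1 _ q; set g := Leuler_gamma R; set l := ln 2.
set Q := LGamma q in G0 *.
(* Dividing by Q = Gamma(q) gives - g - (- 2 l Q - D) / Q = 2 l + D / Q - g, which is the constant
   rho_n. *)
rewrite -[LHS]/(c * (A - B) + f x * (- g - Q^-1 * (- (2 * l) * Q - D))).
have Qn0 : Q != 0 by rewrite gt_eqF.
by field.
Qed.
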